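(* Let $R$ be a root system in $\mathbb{R}^N$, let $R'=\{\alpha_1,\dots,\alpha_n\}$ be a positive orthogonal subsystem of $R$ consisting of $n$ vectors, and let $\kappa=(\kappa_1,\dots,\kappa_n)\in\mathbb{C}^n$ with $\operatorname{Re}\kappa_j>0$ for all $j$. For $\xi\in\mathbb{R}^N$ let $$(T_\xi f)(x)=\partial_\xi f(x)+\sum_{j=1}^n\kappa_j\langle\alpha_j,\xi\rangle\frac{f(x)-f(\tau_{\alpha_j}x)}{\langle x,\alpha_j\rangle},\qquad \tau_{\alpha_j}(x)=x-\frac{\langle x,\alpha_j\rangle}{|\alpha_j|^2}\alpha_j.$$ Define $h:\mathbb{R}^n\times\mathbb{R}^N\to\mathbb{R}^N$ by $h(t,x)=x+\sum_{j=1}^n(t_j-1)\frac{\langle x,\alpha_j\rangle}{|\alpha_j|^2}\alpha_j$, and for $f\in C^\infty(\mathbb{R}^N)$ $$\chi_\kappa(f)(x)=\frac{1}{\Gamma(\kappa)}\int_{[0,1]^n}f(h(t,x))\,w(t)\,dt,\qquad w(t)=\prod_{j=1}^n(1-t_j)^{\kappa_j-1},\quad \Gamma(\kappa)=\prod_{j=1}^n\Gamma(\kappa_j).$$ Then for every $f\in C^\infty(\mathbb{R}^N)$ and $\xi\in\mathbb{R}^N$, $$T_\xi(\chi_\kappa f)(x)=\chi_\kappa(\partial_\xi f)(x)$$ for all $x\in\mathbb{R}^N$ with $\langle x,\alpha_j\rangle\neq0$ for $j=1,\dots,n$.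
   Context: $\langle\cdot,\cdot\rangle$ is the Euclidean inner product, $|x|=\sqrt{\langle x,x\rangle}$, $\partial_\xi$ is the directional derivative. A root system is a finite set $R\subset\mathbb{R}^N\setminus\{0\}$ with $s_\alpha(R)=R$ and $R\cap\mathbb{R}\alpha=\{\pm\alpha\}$ for all $\alpha\in R$, where $s_\alpha(x)=x-2\frac{\langle x,\alpha\rangle}{|\alpha|^2}\alpha$. A subsystem of $R$ is a subset closed under negation and under sums that lie in $R$; it is orthogonal if its roots are pairwise orthogonal (apart from $\pm$ pairs); a positive orthogonal subsystem $R'$ is a subset of an orthogonal subsystem $R''$ with $R''=R'\cup(-R')$, $R'\cap(-R')=\emptyset$. In particular $\alpha_1,\dots,\alpha_n$ are pairwise orthogonal. *)

(* Defs.v *)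
From HB Require Import structures.
From mathcomp Require Import all_boot all_order all_algebra.
From mathcomp Require Import all_classical all_reals all_analysis.
From mathcomp Require Import complex.
Set Implicit Arguments. Unset Strict Implicit. Unset Printing Implicit Defensive.
Import Order.TTheory GRing.Theory Num.Theory.
Import numFieldNormedType.Exports.
Local Open Scope classical_set_scope.
Local Open Scope ring_scope.
Local Open Scope complex_scope.

Section Defs.
Variable R : realType.
Variable N : nat.
Local Notation V := 'rV[R]_N.

Definition dotp (u v : V) : R := \sum_(i < N) u 0 i * v 0 i.

Definition refl (a x : V) : V := x - ((2 * dotp x a) / dotp a a) *: a.

Definition root_system (Rs : seq V) : Prop :=
  [/\ (0 : V) \notin Rs,
      (forall a b, a \in Rs -> b \in Rs -> refl a b \in Rs) &
      (forall a x, a \in Rs -> (x \in Rs /\ exists c : R, x = c *: a) <-> (x = a \/ x = - a))].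

Definition subsystem (S Rs : seq V) : Prop :=
  [/\ {subset S <= Rs},
      (forall a, a \in S -> - a \in S) &
      (forall a b, a \in S -> b \in S -> a + b \in Rs -> a + b \in S)].

Definition orthogonal_subsystem (S Rs : seq V) : Prop :=
  subsystem S Rs /\
  (forall a b, a \in S -> b \in S -> b != a -> b != - a -> dotp a b = 0).

Definition positive_orthogonal_subsystem (P Rs : seq V) : Prop :=
  exists R2 : seq V,
    [/\ orthogonal_subsystem R2 Rs,
        R2 =i P ++ map (fun a => - a) P &
        (forall a, a \in P -> - a \notin P)].

Definition cderive (f : V -> R[i]) (xi : V) (x : V) : R[i] :=
  (('D_xi (fun y => complex.Re (f y))) x)%:C
  + 'i * (('D_xi (fun y => complex.Im (f y))) x)%:C.

Definition cderivable (f : V -> R[i]) (x xi : V) : Prop :=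
  derivable (fun y => complex.Re (f y)) x xi /\
  derivable (fun y => complex.Im (f y)) x xi.

Definition iderive (vs : seq V) (g : V -> R) : V -> R :=
  foldr (fun v h => 'D_v h) g vs.

Definition smooth_real (g : V -> R) : Prop :=
  forall vs : seq V,
    (forall x v, derivable (iderive vs g) x v) /\ continuous (iderive vs g).

Definition smooth (f : V -> R[i]) : Prop :=
  smooth_real (fun y => complex.Re (f y)) /\ smooth_real (fun y => complex.Im (f y)).

End Defs.

Section Integrals.
Variable R : realType.

Definition cintegral (D : set R) (g : R -> R[i]) : R[i] :=
  (Rintegral lebesgue_measure D (fun s => complex.Re (g s)))%:C
  + 'i * (Rintegral lebesgue_measure D (fun s => complex.Im (g s)))%:C.

(* s^z = exp(z ln s) for s > 0 real, z complex *)
Definition cpow (s : R) (z : R[i]) : R[i] :=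
  (expR (complex.Re z * ln s))%:C *
  ((cos (complex.Im z * ln s))%:C + 'i * (sin (complex.Im z * ln s))%:C).

Definition Gamma (z : R[i]) : R[i] :=
  cintegral `]0, +oo[ (fun s => cpow s (z - 1) * (expR (- s))%:C).

Fixpoint iter_int01 (k : nat) (G : (nat -> R) -> R[i]) (t : nat -> R) : R[i] :=
  match k with
  | 0 => G t
  | k'.+1 => cintegral `[0, 1]
               (fun s => iter_int01 k' G (fun j => if j == k' then s else t j))
  end.

Definition cube_integral (n : nat) (G : ('I_n -> R) -> R[i]) : R[i] :=
  iter_int01 n (fun t => G (fun j => t (nat_of_ord j))) (fun _ => 0).
End Integrals.

Section Dunkl.
Variables (R : realType) (N n : nat).
Variables (alpha : 'I_n -> 'rV[R]_N) (kappa : 'I_n -> R[i]).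
Local Notation V := 'rV[R]_N.

Definition tau (a x : V) : V := x - (dotp x a / dotp a a) *: a.

Definition Tdunkl (xi : V) (g : V -> R[i]) (x : V) : R[i] :=
  cderive g xi x
  + \sum_(j < n) kappa j * (dotp (alpha j) xi)%:C
                 * (g x - g (tau (alpha j) x)) / (dotp x (alpha j))%:C.

Definition hmap (t : 'I_n -> R) (x : V) : V :=
  x + \sum_(j < n) ((t j - 1) * dotp x (alpha j) / dotp (alpha j) (alpha j)) *: alpha j.

Definition weight (t : 'I_n -> R) : R[i] :=
  \prod_(j < n) cpow (1 - t j) (kappa j - 1).

Definition Gamma_kappa : R[i] := \prod_(j < n) Gamma (kappa j).

Definition chi (f : V -> R[i]) (x : V) : R[i] :=
  Gamma_kappa^-1 * cube_integral (fun t => f (hmap t x) * weight t).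
End Dunkl.

(* Main.v *)
(** The integral over the cube is an iterated one-variable integral, and
    [wint k] integrates out the coordinates below [k] against the weights,
    keeping the others as parameters.  By dominated convergence [wint k]
    preserves sequentially continuous, locally bounded functions and commutes
    with derivatives in the remaining coordinates.  Hence integration by parts
    in the [j]-th variable is possible at the moment that variable is integrated
    out, without Fubini: as [(1 - s)^kappa_j] is a primitive of
    [- kappa_j (1 - s)^(kappa_j - 1)] that vanishes at [1], and [h(t, tau_j x)]
    is [h(t, x)] with [t_j = 0], the [j]-th difference quotient of [chi f] at [x]
    is [chi] of [(1 - t_j) <alpha_j, xi> / |alpha_j|^2 * (d_{alpha_j} f)(h(t, x))].
    On the other hand [h] is linear in [x], so that [d_xi (f o h_t)] is
    [(d_{h_t xi} f) o h_t], whose [alpha_j]-component has the coefficient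
    [(t_j - 1) <alpha_j, xi> / |alpha_j|^2]; the two contributions cancel and
    only [d_xi f] survives. *)
Require Import Defs.
From HB Require Import structures.
From mathcomp Require Import all_boot all_order all_algebra.
From mathcomp Require Import all_classical all_reals all_analysis.
From mathcomp Require Import measurable_realfun complex.
From mathcomp Require Import ring lra.
Set Implicit Arguments. Unset Strict Implicit. Unset Printing Implicit Defensive.
Import Order.TTheory GRing.Theory Num.Theory.
Import numFieldNormedType.Exports.
Local Open Scope classical_set_scope.
Local Open Scope ring_scope.
Local Open Scope complex_scope.

(** * Integrals of complex functions over the unit interval *)

Section ComplexParts.
Context {R : realType}.
Implicit Types x y : R[i].

Lemma Re_add x y : complex.Re (x + y) = complex.Re x + complex.Re y.
Proof. by case: x y => [a b] [c d]. Qed.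

Lemma Im_add x y : complex.Im (x + y) = complex.Im x + complex.Im y.
Proof. by case: x y => [a b] [c d]. Qed.

Lemma Re_opp x : complex.Re (- x) = - complex.Re x.
Proof. by case: x. Qed.

Lemma Im_opp x : complex.Im (- x) = - complex.Im x.
Proof. by case: x. Qed.

Lemma Re_mul x y :
  complex.Re (x * y) = complex.Re x * complex.Re y - complex.Im x * complex.Im y.
Proof. by case: x y => [a b] [c d]. Qed.

Lemma Im_mul x y :
  complex.Im (x * y) = complex.Re x * complex.Im y + complex.Im x * complex.Re y.
Proof. by case: x y => [a b] [c d]. Qed.

Lemma complex_parts x y :
  complex.Re x = complex.Re y -> complex.Im x = complex.Im y -> x = y.
Proof. by case: x y => [a b] [c d] /= -> ->. Qed.

Lemma addi_parts (a b : R) : a%:C + 'i * b%:C = a +i* b.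
Proof. by apply: complex_parts; rewrite !(Re_add, Im_add, Re_mul, Im_mul) /=; ring. Qed.

End ComplexParts.

(** * Integrals of a fixed weight against bounded multipliers *)

Section BoundedMultiplier.
Context {d : measure_display} {T : measurableType d} {R : realType}.
Variable mu : {measure set T -> \bar R}.
Variable D : set T.
Hypothesis mD : measurable D.
Implicit Types (w p : T -> R).

Lemma integrable_mul_bounded {w p} {K : R} :
  mu.-integrable D (EFin \o w) -> measurable_fun D p ->
  (forall s, D s -> `|p s| <= K) ->
  mu.-integrable D (EFin \o (fun s => p s * w s)).
Proof.
move=> iw mp pK.
have := @integrableMr _ _ _ mu D mD p (EFin \o w) mp _ iw.
apply; exists K; split; first exact: num_real.
by move=> x Kx s Ds; apply: le_trans (pK s Ds) (ltW Kx).
Qed.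

Lemma Rintegral_mul_bounded {w p} {K : R} :
  mu.-integrable D (EFin \o w) -> measurable_fun D p ->
  (forall s, D s -> `|p s| <= K) ->
  `|Rintegral mu D (fun s => p s * w s)| <=
    K * Rintegral mu D (fun s => `|w s|).
Proof.
move=> iw mp pK.
have iwn : mu.-integrable D (EFin \o (fun s => `|w s|)) by exact: integrable_norm.
have ipw := integrable_mul_bounded iw mp pK.
apply: (le_trans (le_normr_Rintegral mD ipw)).
rewrite -RintegralZl//; apply: le_Rintegral => //.
- exact: (integrable_norm ipw).
- by apply: eq_integrable (integrableZl mD K iwn) => // s _ /=; rewrite EFinM.
- by move=> s Ds; rewrite normrM ler_wpM2r// pK.
Qed.

(** Dominated convergence with majorant [K * |w|]; the limit multiplier inherits measurability and
    the bound [K] from the sequence. *)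
Lemma Rintegral_dominated_cvg {w} {p_ : nat -> T -> R} {p} {K : R} :
  mu.-integrable D (EFin \o w) -> (forall i, measurable_fun D (p_ i)) ->
  (forall i s, D s -> `|p_ i s| <= K) ->
  (forall s, D s -> p_ i s @[i --> \oo] --> p s) ->
  Rintegral mu D (fun s => p_ i s * w s) @[i --> \oo] -->
    Rintegral mu D (fun s => p s * w s).
Proof.
move=> iw mp pK pp.
have mpl : measurable_fun D p.
  exact: measurable_fun_cvg mp pp.
have plK s : D s -> `|p s| <= K.
  move=> Ds; have h : `|p_ i s| @[i --> \oo] --> `|p s| by apply: cvg_norm; exact: pp.
  rewrite -(cvg_lim (@norm_hausdorff _ _) h).
  apply: limr_le; first exact: cvgP h.
  by apply: nearW => i; exact: pK.
have iwn : mu.-integrable D (EFin \o (fun s => K * `|w s|)).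
  by apply: eq_integrable (integrableZl mD K (integrable_norm iw)) => // s _ /=;
    rewrite EFinM.
have mw : measurable_fun D w by apply/measurable_EFinP/(measurable_int mu).
have m_ i : measurable_fun D (fun s => (p_ i s * w s)%:E).
  by apply/measurable_EFinP/measurable_funM.
have m : measurable_fun D (fun s => (p s * w s)%:E).
  exact/measurable_EFinP/measurable_funM.
have cv : {ae mu, forall s, D s -> (p_ i s * w s)%:E @[i --> \oo] --> (p s * w s)%:E}.
  apply: aeW => s Ds; apply: cvg_EFin; first exact: nearW.
  by apply: cvgM; [exact: pp|exact: cvg_cst].
have dom : {ae mu, forall s i, D s ->
    (`|(p_ i s * w s)%:E| <= (K * `|w s|)%:E)%E}.
  by apply: aeW => s i Ds /=; rewrite lee_fin normrM ler_wpM2r//; exact: pK.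
have [_ _ cvgI] := dominated_convergence mD m_ m cv iwn dom.
have /integrable_fin_num -/(_ mD) fp := integrable_mul_bounded iw mpl plK.
apply: fine_cvg.
by rewrite fineK.
Qed.

End BoundedMultiplier.

(** * The complex integral, reduced to real and imaginary parts *)

Section ComplexIntegral.
Context {R : realType}.
Local Notation mu := (@lebesgue_measure R).
Local Notation D := (`[0, 1]%classic : set R).
Implicit Types (w p q : R -> R[i]).

Definition cintegrable p : Prop :=
  mu.-integrable D (EFin \o (fun s => complex.Re (p s))) /\
  mu.-integrable D (EFin \o (fun s => complex.Im (p s))).

Definition cmeasurable p : Prop :=
  measurable_fun D (fun s => complex.Re (p s)) /\
  measurable_fun D (fun s => complex.Im (p s)).

Definition cbounded_by (K : R) p : Prop :=
  forall s, D s -> `|complex.Re (p s)| <= K /\ `|complex.Im (p s)| <= K.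

Definition ccvg (u : nat -> R[i]) (l : R[i]) : Prop :=
  (complex.Re (u i) @[i --> \oo] --> complex.Re l) /\
  (complex.Im (u i) @[i --> \oo] --> complex.Im l).

Lemma measurable_unit_itv : measurable (D : set (measurableTypeR R)).
Proof. exact: measurable_itv. Qed.

Local Notation mD := measurable_unit_itv.

Lemma cintegralE p :
  cintegral D p = Rintegral mu D (fun s => complex.Re (p s)) +i*
                  Rintegral mu D (fun s => complex.Im (p s)).
Proof. exact: addi_parts. Qed.

Lemma eq_cintegral p q : (forall s, D s -> p s = q s) ->
  cintegral D p = cintegral D q.
Proof.
by move=> pq; rewrite !cintegralE; congr (_ +i* _);
  apply: eq_Rintegral => s /set_mem Ds; rewrite pq.
Qed.

Lemma cintegralD p q : cintegrable p -> cintegrable q ->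
  cintegral D (fun s => p s + q s) = cintegral D p + cintegral D q.
Proof.
move=> [p1 p2] [q1 q2]; rewrite !cintegralE.
apply: complex_parts; rewrite ?(Re_add, Im_add) /=.
  by rewrite -(RintegralD mD p1 q1); apply: eq_Rintegral => s _; rewrite Re_add.
by rewrite -(RintegralD mD p2 q2); apply: eq_Rintegral => s _; rewrite Im_add.
Qed.

Let integrableZ (c : R) (g : R -> R) : mu.-integrable D (EFin \o g) ->
  mu.-integrable D (EFin \o (fun s => c * g s)).
Proof.
move=> ig; apply: eq_integrable (integrableZl mD c ig); first exact: mD.
by move=> s _; rewrite /= EFinM.
Qed.

Let integrableBr (g h : R -> R) : mu.-integrable D (EFin \o g) ->
  mu.-integrable D (EFin \o h) -> mu.-integrable D (EFin \o (fun s => g s - h s)).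
Proof.
move=> ig ih; apply: eq_integrable (integrableB mD ig ih); first exact: mD.
by move=> s _; rewrite /= EFinB.
Qed.

Let integrableDr (g h : R -> R) : mu.-integrable D (EFin \o g) ->
  mu.-integrable D (EFin \o h) -> mu.-integrable D (EFin \o (fun s => g s + h s)).
Proof.
move=> ig ih; apply: eq_integrable (integrableD mD ig ih); first exact: mD.
by move=> s _; rewrite /= EFinD.
Qed.

Lemma cintegralZ (c : R[i]) p : cintegrable p ->
  cintegral D (fun s => c * p s) = c * cintegral D p.
Proof.
move=> [p1 p2]; rewrite !cintegralE; apply: complex_parts.
  rewrite Re_mul /= -(RintegralZl _ mD p1) -(RintegralZl _ mD p2).
  rewrite -(RintegralB mD (integrableZ (complex.Re c) p1) (integrableZ (complex.Im c) p2)).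
  by apply: eq_Rintegral => s _; rewrite Re_mul.
rewrite Im_mul /= -(RintegralZl _ mD p1) -(RintegralZl _ mD p2).
rewrite -(RintegralD mD (integrableZ (complex.Re c) p2) (integrableZ (complex.Im c) p1)).
by apply: eq_Rintegral => s _; rewrite Im_mul.
Qed.

Lemma cintegrable_mul {w p} {K : R} : cintegrable w -> cmeasurable p ->
  cbounded_by K p -> cintegrable (fun s => p s * w s).
Proof.
move=> [w1 w2] [p1 p2] pK.
have K1 s : D s -> `|complex.Re (p s)| <= K by move/pK => [].
have K2 s : D s -> `|complex.Im (p s)| <= K by move/pK => [].
split.
  apply: eq_integrable (integrableBr (integrable_mul_bounded mD w1 p1 K1)
    (integrable_mul_bounded mD w2 p2 K2)); first exact: mD.
  by move=> s _; rewrite /= Re_mul.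
apply: eq_integrable (integrableDr (integrable_mul_bounded mD w2 p1 K1)
    (integrable_mul_bounded mD w1 p2 K2)); first exact: mD.
by move=> s _; rewrite /= Im_mul.
Qed.

Lemma cintegral_mulE {w p} {K : R} : cintegrable w -> cmeasurable p ->
  cbounded_by K p ->
  cintegral D (fun s => p s * w s) =
    (Rintegral mu D (fun s => complex.Re (p s) * complex.Re (w s)) -
     Rintegral mu D (fun s => complex.Im (p s) * complex.Im (w s))) +i*
    (Rintegral mu D (fun s => complex.Re (p s) * complex.Im (w s)) +
     Rintegral mu D (fun s => complex.Im (p s) * complex.Re (w s))).
Proof.
move=> [w1 w2] [p1 p2] pK; rewrite cintegralE.
have K1 s : D s -> `|complex.Re (p s)| <= K by move/pK => [].
have K2 s : D s -> `|complex.Im (p s)| <= K by move/pK => [].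
rewrite -(RintegralB mD (integrable_mul_bounded mD w1 p1 K1)
  (integrable_mul_bounded mD w2 p2 K2)).
rewrite -(RintegralD mD (integrable_mul_bounded mD w2 p1 K1)
  (integrable_mul_bounded mD w1 p2 K2)).
by congr (_ +i* _); apply: eq_Rintegral => s _; rewrite ?(Re_mul, Im_mul).
Qed.

Lemma cintegral_dominated_cvg {w} {p_ : nat -> R -> R[i]} {p} {K : R} :
  cintegrable w -> (forall i, cmeasurable (p_ i)) -> cmeasurable p ->
  (forall i, cbounded_by K (p_ i)) -> cbounded_by K p ->
  (forall s, D s -> ccvg (p_ ^~ s) (p s)) ->
  ccvg (fun i => cintegral D (fun s => p_ i s * w s))
       (cintegral D (fun s => p s * w s)).
Proof.
move=> iw mp_ mp pK_ pK pp.
have K1 i s : D s -> `|complex.Re (p_ i s)| <= K by move/(pK_ i) => [].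
have K2 i s : D s -> `|complex.Im (p_ i s)| <= K by move/(pK_ i) => [].
have c1 s : D s -> complex.Re (p_ i s) @[i --> \oo] --> complex.Re (p s) by move/pp => [].
have c2 s : D s -> complex.Im (p_ i s) @[i --> \oo] --> complex.Im (p s) by move/pp => [].
have m1 i : measurable_fun D (fun s => complex.Re (p_ i s)) by case: (mp_ i).
have m2 i : measurable_fun D (fun s => complex.Im (p_ i s)) by case: (mp_ i).
have [w1 w2] := iw.
rewrite /ccvg (cintegral_mulE iw mp pK); split.
  under eq_cvg do rewrite (cintegral_mulE iw (mp_ _) (pK_ _)) /=.
  apply: cvgB.
    exact: (Rintegral_dominated_cvg mD w1 m1 K1 c1).
  exact: (Rintegral_dominated_cvg mD w2 m2 K2 c2).
under eq_cvg do rewrite (cintegral_mulE iw (mp_ _) (pK_ _)) /=.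
apply: cvgD.
  exact: (Rintegral_dominated_cvg mD w2 m1 K1 c1).
exact: (Rintegral_dominated_cvg mD w1 m2 K2 c2).
Qed.

(** The constant depends on the weight alone, not on the multiplier: this is what carries uniform
    bounds through an integration. *)
Lemma cintegral_mul_bound w : cintegrable w -> exists2 C : R, 0 <= C &
  forall (p : R -> R[i]) (K : R), 0 <= K -> cmeasurable p -> cbounded_by K p ->
    `|complex.Re (cintegral D (fun s => p s * w s))| <= K * C /\
    `|complex.Im (cintegral D (fun s => p s * w s))| <= K * C.
Proof.
move=> iw; have [w1 w2] := iw.
exists (Rintegral mu D (fun s => `|complex.Re (w s)|) +
        Rintegral mu D (fun s => `|complex.Im (w s)|)).
  by apply: addr_ge0; apply: Rintegral_ge0 => s _; exact: normr_ge0.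
move=> p K K0 mp pK; rewrite (cintegral_mulE iw mp pK) /=; have [p1 p2] := mp.
have K1 s : D s -> `|complex.Re (p s)| <= K by move/pK => [].
have K2 s : D s -> `|complex.Im (p s)| <= K by move/pK => [].
have b11 := Rintegral_mul_bounded mD w1 p1 K1.
have b12 := Rintegral_mul_bounded mD w2 p1 K1.
have b21 := Rintegral_mul_bounded mD w1 p2 K2.
have b22 := Rintegral_mul_bounded mD w2 p2 K2.
split; rewrite mulrDr.
  by apply: (le_trans (ler_normB _ _)); exact: lerD.
by apply: (le_trans (ler_normD _ _)); rewrite addrC; exact: lerD.
Qed.

End ComplexIntegral.

(** * Iterated weighted integrals *)

Section WeightedIntegral.
Context {R : realType}.
Local Notation D := (`[0, 1]%classic : set R).
Local Notation point := (nat -> R).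
Implicit Types (t : point) (F G : point -> R[i]).

(** The body is that of the substitution in [iter_int01], so that the latter can be folded into
    [upd]. *)
Definition upd t (k : nat) (s : R) : point := fun j => if j == k then s else t j.

Lemma upd_same t k s : upd t k s k = s.
Proof. by rewrite /upd eqxx. Qed.

Lemma upd_other t k s j : j != k -> upd t k s j = t j.
Proof. by rewrite /upd => /negbTE ->. Qed.

Lemma upd_upd t k s r : upd (upd t k s) k r = upd t k r.
Proof. by apply/funext => j; rewrite /upd; case: eqP. Qed.

Lemma updC t k m s r : k != m -> upd (upd t k s) m r = upd (upd t m r) k s.
Proof.
move=> km; apply/funext => j; rewrite /upd; case: eqP => // ->.
by rewrite eq_sym (negbTE km).
Qed.

Definition pcvg (u : nat -> point) t : Prop :=
  forall j, u i j @[i --> \oo] --> t j.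

(* Continuous convergence; being stable under passing to slices, it is what lets
   dominated convergence be iterated. *)
Definition contcvg (F_ : nat -> point -> R[i]) F : Prop :=
  forall u t, pcvg u t -> ccvg (fun i => F_ i (u i)) (F t).

(* There are infinitely many coordinates, so a convergent sequence of points is
   bounded in each of them but not uniformly: hence one bound [M j] for each. *)
Definition ubounded (F_ : nat -> point -> R[i]) : Prop :=
  forall M : point, exists K : R, forall i t, (forall j, `|t j| <= M j) ->
    `|complex.Re (F_ i t)| <= K /\ `|complex.Im (F_ i t)| <= K.

(** Sequential continuity and boundedness on boxes, phrased as the constant-sequence case of the two
    notions above, so that one induction on [wint] yields both stability and passage to the
    limit. *)
Definition good F : Prop := contcvg (fun _ => F) F /\ ubounded (fun _ => F).

Lemma pcvg_cst t : pcvg (fun _ => t) t.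
Proof. by move=> j; exact: cvg_cst. Qed.

Lemma pcvg_upd (u : nat -> point) t k (r : nat -> R) (s : R) :
  pcvg u t -> r i @[i --> \oo] --> s ->
  pcvg (fun i => upd (u i) k (r i)) (upd t k s).
Proof. by move=> ut rs j; rewrite /upd; case: eqP. Qed.

Lemma pcvg_bounded (u : nat -> point) t : pcvg u t ->
  exists M : point, forall i j, `|u i j| <= M j.
Proof.
move=> ut.
have h j : exists M : R, forall i, `|u i j| <= M.
  have /cvg_seq_bounded[M [_ uM]] : cvgn (u ^~ j) by apply: cvgP (ut j).
  by exists (M + 1) => i; apply: uM; rewrite ?ltrDl.
by have [M uM] := choice h; exists M.
Qed.

Lemma sequential_continuous (f : R -> R) :
  (forall (r : nat -> R) (s : R), r i @[i --> \oo] --> s ->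
    f (r i) @[i --> \oo] --> f s) -> continuous f.
Proof. by move=> h s; apply/(@cvg_nbhsP _ R^o) => r; exact: h. Qed.

Lemma good_cmeasurable F t k : good F -> cmeasurable (fun s => F (upd t k s)).
Proof.
move=> [cF _]; split; apply: measurable_funTS; apply: continuous_measurable_fun;
  apply: sequential_continuous => r s rs.
  by have [] := cF _ _ (pcvg_upd (k := k) (@pcvg_cst t) rs).
by have [] := cF _ _ (pcvg_upd (k := k) (@pcvg_cst t) rs).
Qed.

Lemma unit_norm (s : R) : D s -> `|s| <= 1.
Proof. by rewrite /= in_itv /= => /andP[s0 s1]; rewrite ger0_norm. Qed.

Lemma ubounded_slice (F_ : nat -> point -> R[i]) (M : point) k : ubounded F_ ->
  exists2 K : R, 0 <= K & forall i t, (forall j, `|t j| <= M j) ->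
    cbounded_by K (fun s => F_ i (upd t k s)).
Proof.
(* On the slice the [k]-th coordinate runs through [0, 1], so its bound becomes 1; the maximum with
   0 makes the constant nonnegative. *)
move=> /(_ (upd M k 1))[K FK]; exists (Num.max K 0); first by rewrite le_max lexx orbT.
move=> i t tM s Ds; have [|h1 h2] := FK i (upd t k s).
  by move=> j; rewrite /upd; case: eqP => // _; exact: unit_norm.
by rewrite !le_max h1 h2.
Qed.

Lemma good_ubounded_slice F t k : good F -> exists2 K : R, 0 <= K &
  cbounded_by K (fun s => F (upd t k s)).
Proof.
move=> [_ bF]; have [K K0 FK] := ubounded_slice (fun j => `|t j|) k bF.
by exists K => //; exact: (FK 0%N).
Qed.

Variable w : nat -> R -> R[i].
Hypothesis iw : forall k, cintegrable (w k).

(** Each weight enters at the integration of its own variable, not under the innermost integral: the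
    partial integrals are then good functions even though the weights may blow up at 1. *)
Fixpoint wint (k : nat) F t : R[i] :=
  match k with
  | 0 => F t
  | k'.+1 => cintegral D (fun s => wint k' F (upd t k' s) * w k' s)
  end.

Lemma good_cintegrable F t k j : good F ->
  cintegrable (fun s => F (upd t k s) * w j s).
Proof.
move=> gF; have [K _ FK] := good_ubounded_slice t k gF.
exact: cintegrable_mul (iw j) (good_cmeasurable t k gF) FK.
Qed.

(** Convergence and boundedness go through the induction together, since dominated convergence at
    one stage uses the bound obtained at the stage before. The sequence is kept general so that the
    induction hypothesis also applies to constant ones. *)
Lemma wint_contcvg k : forall (F_ : nat -> point -> R[i]) F,
  (forall i, good (F_ i)) -> good F -> contcvg F_ F -> ubounded F_ ->
  contcvg (fun i => wint k (F_ i)) (wint k F) /\ ubounded (fun i => wint k (F_ i)).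
Proof.
elim: k => [//|k IH] F_ F gF_ gF cF bF.
have gk G : good G -> good (wint k G).
  by move=> gG; have [] := gG; exact: IH.
have [ck bk] := IH _ _ gF_ gF cF bF; split => /=.
  (* The base points move with [i], but a convergent sequence stays in one box [M], which gives a
     single dominating constant. *)
  move=> u t ut; have [M uM] := pcvg_bounded ut.
  have [K K0 FK] := ubounded_slice M k bk.
  have [K' K'0 FK'] := good_ubounded_slice t k (gk _ gF).
  have le_bound (a b : R) p : a <= b -> cbounded_by a p -> cbounded_by b p.
    by move=> ab pa s Ds; have [h1 h2] := pa s Ds; split; exact: le_trans ab.
  apply: (@cintegral_dominated_cvg _ (w k)
    (fun i s => wint k (F_ i) (upd (u i) k s))
    (fun s => wint k F (upd t k s)) (Num.max K K')).
  - exact: iw.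
  - by move=> i; apply: good_cmeasurable; exact: gk.
  - by apply: good_cmeasurable; exact: gk.
  - move=> i; apply: (le_bound K); first by rewrite le_max lexx.
    by apply: FK => j; exact: uM.
  - by apply: (le_bound K') => //; rewrite le_max lexx orbT.
  - by move=> s Ds; apply: ck; apply: pcvg_upd => //; exact: cvg_cst.
move=> M; have [K K0 FK] := ubounded_slice M k bk.
have [C C0 wC] := cintegral_mul_bound (iw k).
exists (K * C) => i t tM; apply: wC => //; last exact: FK.
by apply: good_cmeasurable; exact: gk.
Qed.

Lemma good_wint k F : good F -> good (wint k F).
Proof. by move=> gF; have [] := gF; exact: wint_contcvg. Qed.

Lemma eq_wint k F G : F =1 G -> wint k F =1 wint k G.
Proof. by move/funext ->. Qed.

Lemma wintD k F G t : good F -> good G ->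
  wint k (fun t => F t + G t) t = wint k F t + wint k G t.
Proof.
move=> gF gG; elim: k t => [//|k IH] t /=.
rewrite -cintegralD; last 2 first.
- by apply: good_cintegrable; exact: good_wint.
- by apply: good_cintegrable; exact: good_wint.
by apply: eq_cintegral => s _; rewrite IH mulrDl.
Qed.

(** The scalar may depend on the coordinates that are not integrated out; in this way the factor
    [1 - t_j] passes through the integrals below [j]. *)
Lemma wintZ k (c : point -> R[i]) F t : good F ->
  (forall t j s, (j < k)%N -> c (upd t j s) = c t) ->
  wint k (fun t => c t * F t) t = c t * wint k F t.
Proof.
move=> gF; elim: k t => [//|k IH] t ck /=.
rewrite -cintegralZ; last by apply: good_cintegrable; exact: good_wint.
apply: eq_cintegral => s _; rewrite IH; last by move=> ? j ? jk; rewrite ck// ltnW.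
by rewrite ck// mulrA.
Qed.

Lemma wint_upd k m (r : R) F t : (k <= m)%N ->
  wint k (fun t => F (upd t m r)) t = wint k F (upd t m r).
Proof.
elim: k t => [//|k IH] t km /=; apply: eq_cintegral => s _.
by rewrite IH ?(ltnW km)// updC// neq_ltn km.
Qed.

End WeightedIntegral.

(** * Closure properties of good functions *)

Section GoodFunctions.
Context {R : realType}.
Local Notation point := (nat -> R).
Implicit Types (t : point) (F G : point -> R[i]).

Lemma ccvgD (u v : nat -> R[i]) a b : ccvg u a -> ccvg v b ->
  ccvg (fun i => u i + v i) (a + b).
Proof.
move=> [u1 u2] [v1 v2]; split; rewrite ?(Re_add, Im_add).
  by under eq_cvg do rewrite Re_add; exact: cvgD.
by under eq_cvg do rewrite Im_add; exact: cvgD.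
Qed.

Lemma ccvgM (u v : nat -> R[i]) a b : ccvg u a -> ccvg v b ->
  ccvg (fun i => u i * v i) (a * b).
Proof.
move=> [u1 u2] [v1 v2]; split; rewrite ?(Re_mul, Im_mul).
  by under eq_cvg do rewrite Re_mul; apply: cvgB; exact: cvgM.
by under eq_cvg do rewrite Im_mul; apply: cvgD; exact: cvgM.
Qed.

Lemma goodD F G : good F -> good G -> good (fun t => F t + G t).
Proof.
move=> [cF bF] [cG bG]; split; first by move=> u t ut; apply: ccvgD; [exact: cF|exact: cG].
move=> M; have [K FK] := bF M; have [L GL] := bG M; exists (K + L) => i t tM.
have [f1 f2] := FK i t tM; have [g1 g2] := GL i t tM.
rewrite Re_add Im_add.
by split; apply: (le_trans (ler_normD _ _)); exact: lerD.
Qed.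

Lemma goodM F G : good F -> good G -> good (fun t => F t * G t).
Proof.
move=> [cF bF] [cG bG]; split; first by move=> u t ut; apply: ccvgM; [exact: cF|exact: cG].
move=> M; have [K FK] := bF M; have [L GL] := bG M; exists (K * L + K * L) => i t tM.
have [f1 f2] := FK i t tM; have [g1 g2] := GL i t tM.
rewrite Re_mul Im_mul; split.
  by apply: (le_trans (ler_normB _ _)); apply: lerD; rewrite normrM; apply: ler_pM.
by apply: (le_trans (ler_normD _ _)); apply: lerD; rewrite normrM; apply: ler_pM.
Qed.

Lemma good_cst (c : R[i]) : good (fun _ : point => c).
Proof.
split; first by move=> u t _; split; exact: cvg_cst.
move=> M; exists (`|complex.Re c| + `|complex.Im c|) => _ _ _.
by split; rewrite ?lerDl ?lerDr.
Qed.

Lemma good_coord j : good (fun t : point => (t j)%:C).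
Proof.
split; first by move=> u t ut; split; [exact: ut|exact: cvg_cst].
by move=> M; exists (M j) => _ t tM; rewrite /= normr0; split => //; exact: le_trans (tM j).
Qed.

Lemma goodN F : good F -> good (fun t => - F t).
Proof.
by move=> gF; have := goodM (good_cst (- 1)) gF; under eq_fun do rewrite mulN1r.
Qed.

Lemma goodB F G : good F -> good G -> good (fun t => F t - G t).
Proof. by move=> gF gG; apply: goodD => //; exact: goodN. Qed.

Lemma good_sum (I : finType) (F_ : I -> point -> R[i]) : (forall i, good (F_ i)) ->
  good (fun t => \sum_i F_ i t).
Proof.
move=> gF; elim: (index_enum I) => [|i s IH].
  by under eq_fun do rewrite big_nil; exact: good_cst.
by under eq_fun do rewrite big_cons; exact: goodD.
Qed.

Lemma good_upd m (r : R) F : good F -> good (fun t => F (upd t m r)).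
Proof.
move=> [cF bF]; split.
  by move=> u t ut; apply: cF; apply: pcvg_upd => //; exact: cvg_cst.
move=> M; have [K FK] := bF (upd M m `|r|); exists K => i t tM.
by apply: (FK i) => j; rewrite /upd; case: eqP.
Qed.

End GoodFunctions.

(** * Differentiation under the integral sign *)

Section PartialDerivative.
Context {R : realType}.
Local Notation point := (nat -> R).
Implicit Types (t : point) (F G : point -> R[i]).

(** Dominated convergence supplies limits along sequences only; this turns them into derivatives. *)
Lemma is_derive_sequential (f : R -> R) (s d : R) :
  (forall r : nat -> R, (forall i, r i != s) -> r i @[i --> \oo] --> s ->
    (r i - s)^-1 * (f (r i) - f s) @[i --> \oo] --> d) ->
  is_derive s 1 f d.
Proof.
move=> h; have hd : h^-1 *: (f (h *: 1 + s) - f s) @[h --> 0^'] --> d.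
  apply/cvgr_dnbhsP => u [u0 cu].
  have rs i : u i + s != s by rewrite -subr_eq0 addrK.
  have cr : u i + s @[i --> \oo] --> s.
    by rewrite -[X in _ --> X]add0r; apply: cvgD => //; exact: cvg_cst.
  have := h _ rs cr; under eq_cvg do rewrite addrK.
  by under [X in _ -> X]eq_cvg do rewrite [_ *: 1]mulr1.
apply: DeriveDef; first exact: cvgP hd.
exact: cvg_lim hd.
Qed.

(** [a] and [b] come in either order, and [c] is located only by its distance to [a], which is
    enough to squeeze it towards [a] when [b] tends to [a]. *)
Lemma mean_value (f f' : R -> R) : (forall s : R, is_derive s 1 f (f' s)) ->
  forall a b, exists c, `|c - a| <= `|b - a| /\ f b - f a = f' c * (b - a).
Proof.
move=> df a b.
have cf : continuous f.
  by move=> s; apply/differentiable_continuous/derivable1_diffP; have [] := df s.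
have [ab|ba] := leP a b.
  have [|c] := MVT_segment ab (fun x _ => df x); first exact: continuous_subspaceT.
  rewrite in_itv /= => /andP[ac cb] e; exists c; split => //.
  by rewrite !ger0_norm ?subr_ge0// lerD2r.
have [|c] := MVT_segment (ltW ba) (fun x _ => df x); first exact: continuous_subspaceT.
rewrite in_itv /= => /andP[bc ca] e; exists c; split.
  by rewrite !ler0_norm ?subr_le0 ?(ltW ba)// lerN2 lerD2r.
by rewrite -[LHS]opprB e -mulrN opprB.
Qed.

(** The slices are differentiated on the whole line and not just on [0, 1], so that the mean value
    theorem applies without care for endpoints. *)
Definition pderiv m F F' : Prop := forall t (s : R),
  is_derive s 1 (fun r => complex.Re (F (upd t m r))) (complex.Re (F' (upd t m s))) /\
  is_derive s 1 (fun r => complex.Im (F (upd t m r))) (complex.Im (F' (upd t m s))).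

Variable w : nat -> R -> R[i].
Hypothesis iw : forall k, cintegrable (w k).

Section DifferenceQuotient.
Variables (m : nat) (F F' : point -> R[i]).
Hypotheses (gF : good F) (gF' : good F') (dF : pderiv m F F').
Variables (s : R) (r : nat -> R).
Hypotheses (rs : forall i, r i != s) (cr : r i @[i --> \oo] --> s).

Let Q i t := ((r i - s)^-1)%:C * (F (upd t m (r i)) - F (upd t m s)).

(** The mean value theorem holds for real functions only: the real and the imaginary part have
    separate intermediate points. *)
Let QE i t : exists c : R * R, [/\ `|c.1 - s| <= `|r i - s|,
  complex.Re (Q i t) = complex.Re (F' (upd t m c.1)), `|c.2 - s| <= `|r i - s| &
  complex.Im (Q i t) = complex.Im (F' (upd t m c.2))].
Proof.
have h : r i - s != 0 by rewrite subr_eq0.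
have [c1 [b1 e1]] := mean_value (fun s => (dF t s).1) s (r i).
have [c2 [b2 e2]] := mean_value (fun s => (dF t s).2) s (r i).
exists (c1, c2); split => //=.
  rewrite Re_mul Re_add Re_opp /= mul0r subr0 [X in _ * X]e1.
  by rewrite mulrCA mulVf// mulr1.
rewrite Im_mul Im_add Im_opp /= mul0r addr0 [X in _ * X]e2.
by rewrite mulrCA mulVf// mulr1.
Qed.

(** The quotients are values of [F'] at intermediate points that are squeezed towards [s], so the
    continuity of [F'] gives the limit even along moving base points. *)
Lemma difference_quotient_contcvg : contcvg Q (fun t => F' (upd t m s)).
Proof.
move=> u t ut; have [c cE] := choice (fun i => QE i (u i)).
have squeeze (b : nat -> R) : (forall i, `|b i - s| <= `|r i - s|) ->
    b i @[i --> \oo] --> s.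
  move=> bs; apply/cvgrPdist_le => e e0; move/cvgrPdist_le : cr => /(_ e e0).
  by apply: filterS => i; rewrite distrC => /(le_trans (bs i)); rewrite distrC.
have [cF' _] := gF'.
have c1 := squeeze (fun i => (c i).1) (fun i => let: And4 h _ _ _ := cE i in h).
have c2 := squeeze (fun i => (c i).2) (fun i => let: And4 _ _ h _ := cE i in h).
split.
  under eq_cvg do rewrite (let: And4 _ h _ _ := cE _ in h).
  by have [] := cF' _ _ (pcvg_upd (k := m) ut c1).
under eq_cvg do rewrite (let: And4 _ _ _ h := cE _ in h).
by have [] := cF' _ _ (pcvg_upd (k := m) ut c2).
Qed.

Lemma difference_quotient_ubounded : ubounded Q.
Proof.
move=> M; have [B [_ rB]] : bounded_fun r by apply: cvg_seq_bounded; exact: cvgP cr.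
(* As [|r i| <= B + 1], an intermediate point satisfies [|c| <= |r i - s| + |s| <= B + 1 + |s| +
   |s|]. *)
have [_ /(_ (upd M m (B + 1 + `|s| + `|s|)))[K FK]] := gF'.
exists K => i t tM.
have near c : `|c - s| <= `|r i - s| ->
    forall j, `|upd t m c j| <= upd M m (B + 1 + `|s| + `|s|) j.
  move=> cs j; rewrite /upd; case: eqP => // _.
  rewrite -[c](subrK s) (le_trans (ler_normD _ _))// lerD2r (le_trans cs)//.
  by rewrite (le_trans (ler_normB _ _))// lerD2r; apply: rB => //; rewrite ltrDl.
have [c [h1 -> h2 ->]] := QE i t.
by split; [have [] := FK 0%N _ (near _ h1)|have [] := FK 0%N _ (near _ h2)].
Qed.

Lemma good_difference_quotient i : good (Q i).
Proof.
by apply: goodM; [exact: good_cst|apply: goodB; exact: good_upd].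
Qed.

Lemma wint_difference_quotient k i t : (k <= m)%N -> wint w k (Q i) t =
  ((r i - s)^-1)%:C * (wint w k F (upd t m (r i)) - wint w k F (upd t m s)).
Proof.
move=> km; have gU x : good (fun t => F (upd t m x)) by exact: good_upd.
rewrite (wintZ iw (c := fun _ => ((r i - s)^-1)%:C))//; last exact: goodB.
rewrite (wintD iw)//; last exact: goodN.
congr (_ * (_ + _)); first exact: wint_upd.
under [X in wint w k X t]eq_fun do rewrite -mulN1r.
by rewrite (wintZ iw (c := fun _ => -1))// mulN1r wint_upd.
Qed.

End DifferenceQuotient.

(** As [m] is a mere parameter of [wint k], the difference quotients of [wint k F] are the integrals
    of those of [F], and the latter converge continuously to [F'] within uniform bounds. *)
Lemma wint_pderiv k m F F' : (k <= m)%N -> good F -> good F' ->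
  pderiv m F F' -> pderiv m (wint w k F) (wint w k F').
Proof.
move=> km gF gF' dF t s.
have qcvg (r : nat -> R) : (forall i, r i != s) -> r i @[i --> \oo] --> s ->
  ccvg (fun i => ((r i - s)^-1)%:C *
           (wint w k F (upd t m (r i)) - wint w k F (upd t m s)))
       (wint w k F' (upd t m s)).
  move=> rs cr.
  have [+ _] := wint_contcvg iw k (good_difference_quotient m gF s r)
    (good_upd m s gF') (difference_quotient_contcvg gF' dF rs cr)
    (difference_quotient_ubounded gF' dF rs cr).
  move=> /(_ _ _ (@pcvg_cst _ t)); rewrite wint_upd//.
  by congr (ccvg _ _); apply/funext => i; rewrite wint_difference_quotient.
split; apply: is_derive_sequential => r rs cr; have [h1 h2] := qcvg r rs cr.
  by move: h1; under eq_cvg do rewrite Re_mul Re_add Re_opp /= mul0r subr0.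
by move: h2; under eq_cvg do rewrite Im_mul Im_add Im_opp /= mul0r addr0.
Qed.

End PartialDerivative.

(** * Improper integrals at 1 and the weight [(1 - s)^(z - 1)] *)

Section Truncation.
Context {R : realType}.
Local Notation mu := (@lebesgue_measure R).
Local Notation D := (`[0, 1]%classic : set R).

(* With this choice [ln (1 - trunc n) = - n.+1], so that [(1 - trunc n)^z] decays
   geometrically. *)
Definition trunc (n : nat) : R := 1 - expR (- 1) ^+ n.+1.

Lemma expN1_lt1 : expR (- 1) < 1 :> R.
Proof. by rewrite -[ltRHS]expR0 ltr_expR ltrN10. Qed.

Lemma trunc_lt1 n : trunc n < 1.
Proof. by rewrite /trunc ltrBlDr ltrDl exprn_gt0// expR_gt0. Qed.

Lemma trunc_gt0 n : 0 < trunc n.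
Proof. by rewrite /trunc subr_gt0 exprn_ilt1// ?expR_ge0// expN1_lt1. Qed.

Lemma trunc_cvg : trunc n @[n --> \oo] --> (1 : R).
Proof.
rewrite -[X in _ --> X]subr0; apply: cvgB; first exact: cvg_cst.
rewrite (cvg_shiftS (fun n => expR (- 1) ^+ n)); apply: cvg_expr.
by rewrite ger0_norm ?expR_ge0// expN1_lt1.
Qed.

Lemma trunc_homo : {homo trunc : n m / (n <= m)%N >-> n <= m}.
Proof.
move=> n m nm; rewrite /trunc lerB// ler_wiXn2l ?expR_ge0//.
Qed.

Lemma bigcup_trunc : \bigcup_n `[0, trunc n]%classic = (`[0, 1[%classic : set R).
Proof.
apply/seteqP; split => s /=.
  by move=> [n _ /=]; rewrite !in_itv /= => /andP[-> /le_lt_trans -> //]; exact: trunc_lt1.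
rewrite in_itv /= => /andP[s0 s1].
have /cvgrPdist_lt/(_ (1 - s)) := trunc_cvg.
rewrite subr_gt0 => /(_ s1)[n _ /(_ n (leqnn n))] /=.
rewrite ger0_norm ?subr_ge0 ?(ltW (trunc_lt1 n))// => h.
by exists n => //=; rewrite in_itv /= s0 /=; lra.
Qed.

Section FTC.
Variables H h : R -> R.
Hypothesis dH : forall s : R, s < 1 -> is_derive s 1 H (h s).
Hypothesis ch : forall s : R, s < 1 -> {for s, continuous h}.

Lemma integral_trunc n :
  (\int[mu]_(s in `[0%R, trunc n]) (h s)%:E = (H (trunc n) - H 0)%R%:E)%E.
Proof.
rewrite EFinB; have t0 := trunc_gt0 n; have t1 := trunc_lt1 n.
have cH (s : R) : s < 1 -> {for s, continuous H}.
  by move=> /dH[dHs _]; apply/differentiable_continuous/derivable1_diffP.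
apply: continuous_FTC2 => //.
- apply/continuous_in_subspaceT => s /set_mem; rewrite /= in_itv /= => /andP[_ st].
  by apply: ch; exact: le_lt_trans t1.
- split.
  + by move=> s; rewrite in_itv /= => /andP[_ st]; have [] := dH (lt_trans st t1).
  + by apply: cvg_at_right_filter; apply: cH; exact: ltr01.
  + by apply: cvg_at_left_filter; exact: cH.
- move=> s; rewrite in_itv /= => /andP[_ st]; rewrite derive1E.
  by have [_] := dH (lt_trans st t1).
Qed.

Lemma measurable_lt1 : measurable_fun D h.
Proof.
have : measurable_fun (`]-oo, 1[%classic : set R) h.
  by apply: open_continuous_measurable_fun => // s; rewrite inE /= in_itv /=; exact: ch.
move=> mh; apply/(measurable_fun_itv_bndo_bndcP (BLeft 0) 1 h).
apply: measurable_funS mh => // s /=; rewrite !in_itv /=.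
by move=> /andP[].
Qed.

(** Monotone convergence along the intervals [[0, trunc n]], on which the integral of [h] is an
    increment of its primitive [H]. *)
Lemma integrable_trunc (C : R) : (forall s : R, s < 1 -> 0 <= h s) ->
  (forall n, H (trunc n) - H 0 <= C) -> mu.-integrable D (EFin \o h).
Proof.
move=> h0 HC; apply/integrableP; split; first by apply/measurable_EFinP; exact: measurable_lt1.
rewrite -integral_itv_bndo_bndc; last first.
  apply: measurableT_comp => //; apply/measurable_EFinP.
  apply: measurable_funS measurable_lt1 => //.
  by apply: subset_itvl; rewrite bnd_simp.
rewrite [ltLHS](_ : _ = \int[mu]_(s in `[0%R, 1%R[) (h s)%:E)%E; last first.
  by apply: eq_integral => s /set_mem; rewrite /= in_itv /= => /andP[_ s1]; rewrite ger0_norm ?h0.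
apply: (@le_lt_trans _ _ C%:E); last exact: ltry.
rewrite -bigcup_trunc.
have cvgI : (\int[mu]_(s in `[0%R, trunc n]) (h s)%:E)%E @[n --> \oo] -->
    (\int[mu]_(s in \bigcup_n `[0%R, trunc n]%classic) (h s)%:E)%E.
  apply: ge0_nondecreasing_set_cvg_integral => //.
  - move=> n m nm; apply/subsetPset/subset_itvl; rewrite bnd_simp.
    exact: trunc_homo.
  - move=> n; apply/measurable_EFinP; apply: measurable_funS measurable_lt1 => //.
    by apply: subset_itvl; rewrite bnd_simp; exact/ltW/trunc_lt1.
  - move=> n s; rewrite /= in_itv /= => /andP[_ st]; rewrite lee_fin h0//.
    exact: le_lt_trans (trunc_lt1 n).
rewrite -(cvg_lim _ cvgI)//; apply: lime_le; first exact: cvgP cvgI.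
by apply: nearW => n; rewrite integral_trunc lee_fin.
Qed.

Let Rintegral_indic (A : set (measurableTypeR R)) : A `<=` D ->
  Rintegral mu D (fun s => \1_A s * h s) = Rintegral mu A h.
Proof.
move=> AD; have -> : A = D `&` A by apply/seteqP; split => s // => [/[dup] /AD|[]].
rewrite Rintegral_mkcondr patch_indic.
by apply: eq_Rintegral => s /set_mem Ds; rewrite /= mulrC !indicE in_setI mem_set.
Qed.

(** The integrals over [[0, trunc n]] have two limits: one by dominated convergence, with indicators
    as bounded multipliers, the other by the fundamental theorem of calculus. *)
Lemma improper_FTC (l : R) : mu.-integrable D (EFin \o h) ->
  H (trunc n) @[n --> \oo] --> l -> Rintegral mu D h = l - H 0.
Proof.
move=> ih cl.
have mp i : measurable_fun D (\1_(`[0, trunc i]%classic) : R -> R).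
  by apply: measurable_indic.
have pK i (s : R) : D s -> `|\1_(`[0, trunc i]%classic) s : R| <= 1.
  by move=> _; rewrite indicE; case: (_ \in _); rewrite ?normr1 ?normr0.
(* The limit is the indicator of the half-open interval: at [s = 1] nothing is known about [h], and
   this endpoint is negligible. *)
have pp (s : R) : D s ->
    \1_(`[0, trunc i]%classic) s @[i --> \oo] --> (\1_(`[0, 1[%classic) s : R).
  rewrite /= in_itv /= => /andP[s0 s1].
  have [s1'|s1'] := ltP s 1; last first.
    rewrite [X in _ --> X]indicE memNset; last first.
      by rewrite /= in_itv /= ltNge s1' andbF.
    rewrite (_ : (fun i => _) = fun _ => 0); first exact: cvg_cst.
    apply/funext => i; rewrite indicE memNset// /= in_itv /= => /andP[_].
    by rewrite leNgt (lt_le_trans (trunc_lt1 i) s1').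
  rewrite [X in _ --> X]indicE mem_set; last by rewrite /= in_itv /= s0.
  have := bigcup_trunc => /seteqP[_ /(_ s)] /=; rewrite in_itv /= s0 s1'.
  move=> /(_ isT)[N _ /=]; rewrite in_itv /= => /andP[_ sN].
  apply: cvg_near_cst; exists N => // i /= Ni; rewrite indicE mem_set//=.
  by rewrite in_itv /= s0 (le_trans sN)// trunc_homo.
have cvgI := Rintegral_dominated_cvg measurable_unit_itv ih mp pK pp.
have sub01 : `[0, 1[%classic `<=` D by apply: subset_itvl; rewrite bnd_simp.
have subt i : `[0, trunc i]%classic `<=` D.
  by apply: subset_itvl; rewrite bnd_simp; exact/ltW/trunc_lt1.
rewrite -Rintegral_itv_bndo_bndc; last exact: integrableS ih.
rewrite -Rintegral_indic//.
have cvgI' : Rintegral mu D (fun s => \1_(`[0, trunc i]%classic) s * h s)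
    @[i --> \oo] --> l - H 0.
  under eq_cvg do rewrite Rintegral_indic// /Rintegral integral_trunc /=.
  by apply: cvgB => //; exact: cvg_cst.
exact: cvg_unique cvgI cvgI'.
Qed.

End FTC.
End Truncation.

(** * Derivative, integrability and decay of complex powers of [1 - s] *)

Section ComplexPower.
Context {R : realType}.
Local Notation mu := (@lebesgue_measure R).
Local Notation D := (`[0, 1]%classic : set R).
Implicit Types (s : R) (z : R[i]).

Lemma Re_cpow s z : complex.Re (cpow s z) =
  expR (complex.Re z * ln s) * cos (complex.Im z * ln s).
Proof. by rewrite /cpow addi_parts Re_mul /= mul0r subr0. Qed.

Lemma Im_cpow s z : complex.Im (cpow s z) =
  expR (complex.Re z * ln s) * sin (complex.Im z * ln s).
Proof. by rewrite /cpow addi_parts Im_mul /= mul0r addr0. Qed.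

Lemma expR_ln_pred s (a : R) : 0 < s ->
  expR ((a - 1) * ln s) = expR (a * ln s) * s^-1.
Proof. by move=> s0; rewrite mulrBl mul1r expRD expRN lnK. Qed.

(* False at [s = 0], where [ln 0 = 0] makes [cpow 0 z = 1]. *)
Lemma cpow_pred s z : 0 < s -> cpow s z = s%:C * cpow s (z - 1).
Proof.
move=> s0; have s1 : s != 0 by rewrite gt_eqF.
apply: complex_parts.
  rewrite [RHS]Re_mul !Re_cpow !Im_cpow /= Re_add Im_add Re_opp Im_opp /= oppr0 addr0 expR_ln_pred// mul0r subr0.
  by field.
rewrite [RHS]Im_mul !Re_cpow !Im_cpow /= Re_add Im_add Re_opp Im_opp /= oppr0 addr0 expR_ln_pred// mul0r addr0.
by field.
Qed.

Lemma is_derive_ln_onem s : s < 1 ->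
  is_derive s 1 (fun s => ln (1 - s)) (- (1 - s)^-1).
Proof.
move=> s1; have dln : is_derive (1 - s) 1 (@ln R) (1 - s)^-1.
  by apply: is_derive1_ln; rewrite subr_gt0.
apply: is_derive_eq.
by rewrite /= add0r mul1r mulrN1.
Qed.

Lemma is_derive_expR_ln s (a : R) : s < 1 ->
  is_derive s 1 (fun s => expR (a * ln (1 - s))) (- (a * expR ((a - 1) * ln (1 - s)))).
Proof.
move=> s1; have d := is_derive_ln_onem s1.
have dl : is_derive s 1 (fun s => a * ln (1 - s)) (a * - (1 - s)^-1).
  exact: is_deriveZ.
apply: (is_derive_eq (is_derive1_comp (is_derive_expR _) dl)).
by rewrite expR_ln_pred ?subr_gt0// /GRing.scale /=; ring.
Qed.

Lemma is_derive_Re_cpow s z : s < 1 ->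
  is_derive s 1 (fun s => complex.Re (cpow (1 - s) z))
    (- complex.Re (z * cpow (1 - s) (z - 1))).
Proof.
move=> s1; have d := is_derive_ln_onem s1.
have dl : is_derive s 1 (fun s => complex.Im z * ln (1 - s))
    (complex.Im z * - (1 - s)^-1) by exact: is_deriveZ.
have dc : is_derive s 1 (fun s => cos (complex.Im z * ln (1 - s)))
    (complex.Im z * (1 - s)^-1 * sin (complex.Im z * ln (1 - s))).
  apply: (is_derive_eq (is_derive1_comp (is_derive_cos _) dl)).
  by rewrite /GRing.scale /=; ring.
have de := is_derive_expR_ln (complex.Re z) s1.
under eq_fun do rewrite Re_cpow.
apply: (is_derive_eq (is_deriveM de dc)).
rewrite Re_mul Re_cpow Im_cpow Re_add Im_add Re_opp Im_opp /= oppr0 addr0.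
by rewrite expR_ln_pred ?subr_gt0// /GRing.scale /=; ring.
Qed.

Lemma is_derive_Im_cpow s z : s < 1 ->
  is_derive s 1 (fun s => complex.Im (cpow (1 - s) z))
    (- complex.Im (z * cpow (1 - s) (z - 1))).
Proof.
move=> s1; have d := is_derive_ln_onem s1.
have dl : is_derive s 1 (fun s => complex.Im z * ln (1 - s))
    (complex.Im z * - (1 - s)^-1) by exact: is_deriveZ.
have dc : is_derive s 1 (fun s => sin (complex.Im z * ln (1 - s)))
    (- (complex.Im z * (1 - s)^-1 * cos (complex.Im z * ln (1 - s)))).
  apply: (is_derive_eq (is_derive1_comp (is_derive_sin _) dl)).
  by rewrite /GRing.scale /=; ring.
have de := is_derive_expR_ln (complex.Re z) s1.
under eq_fun do rewrite Im_cpow.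
apply: (is_derive_eq (is_deriveM de dc)).
rewrite Im_mul Re_cpow Im_cpow Re_add Im_add Re_opp Im_opp /= oppr0 addr0.
by rewrite expR_ln_pred ?subr_gt0// /GRing.scale /=; ring.
Qed.

Lemma is_derive_continuous (f : R -> R) s (d : R) :
  is_derive s 1 f d -> {for s, continuous f}.
Proof. by move=> [ds _]; apply/differentiable_continuous/derivable1_diffP. Qed.

Lemma integrable_expR_ln (a : R) : 0 < a ->
  mu.-integrable D (EFin \o (fun s => expR ((a - 1) * ln (1 - s)))).
Proof.
move=> a0.
(* The primitive is [- (1 - s)^a / a]. *)
have dH s : s < 1 -> is_derive s 1 (fun s => - a^-1 * expR (a * ln (1 - s)))
    (expR ((a - 1) * ln (1 - s))).
  move=> s1; apply: (is_derive_eq (is_deriveZ _ (is_derive_expR_ln a s1))).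
  by rewrite /GRing.scale /=; field; rewrite gt_eqF.
apply: (integrable_trunc dH) => [s s1|s s1|n].
- exact: is_derive_continuous (is_derive_expR_ln (a - 1) s1).
- exact: expR_ge0.
(* The primitive is [- a^-1] at 0 and nowhere positive, so its increments from 0 are at most
   [a^-1]. *)
- instantiate (1 := a^-1).
  rewrite subr0 ln1 mulr0 expR0 mulr1 opprK gerDr mulNr oppr_le0.
  by rewrite mulr_ge0// ?invr_ge0 ?expR_ge0// ltW.
Qed.

Lemma measurable_cpow z : cmeasurable (fun s => cpow (1 - s) z).
Proof.
have ml : measurable_fun [set: R] (fun s : R => ln (1 - s)).
  by apply: measurableT_comp => //; apply: measurable_funB.
have mla (a : R) : measurable_fun [set: R] (fun s : R => a * ln (1 - s)).
  by apply: measurable_funM.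
split; apply: measurable_funTS.
  under eq_fun do rewrite Re_cpow; apply: measurable_funM.
    exact: measurableT_comp.
  apply: (@measurableT_comp _ _ _ _ _ _ (@cos R)) => //.
  by apply: continuous_measurable_fun; exact: continuous_cos.
under eq_fun do rewrite Im_cpow; apply: measurable_funM.
  exact: measurableT_comp.
apply: (@measurableT_comp _ _ _ _ _ _ (@sin R)) => //.
by apply: continuous_measurable_fun; exact: continuous_sin.
Qed.

(** The cosine and sine factors are at most 1 in absolute value, so [(1 - s)^(Re z - 1)] is a
    majorant, integrable as [Re z > 0]. *)
Lemma cintegrable_cpow z : 0 < complex.Re z ->
  cintegrable (fun s => cpow (1 - s) (z - 1)).
Proof.
move=> z0; have iE := integrable_expR_ln z0.
have rE : complex.Re (z - 1) = complex.Re z - 1 by rewrite Re_add.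
have [m1 m2] := measurable_cpow (z - 1).
split; apply: le_integrable iE; try exact: measurable_unit_itv.
- exact/measurable_EFinP.
- move=> s _; suff: `|complex.Re (cpow (1 - s) (z - 1))| <=
    `|expR ((complex.Re z - 1) * ln (1 - s))| by [].
  by rewrite Re_cpow rE normrM ler_piMr// cos_max.
- exact/measurable_EFinP.
- move=> s _; suff: `|complex.Im (cpow (1 - s) (z - 1))| <=
    `|expR ((complex.Re z - 1) * ln (1 - s))| by [].
  by rewrite Im_cpow rE normrM ler_piMr// sin_max.
Qed.

(** This kills the boundary term at 1: along [trunc] the modulus is [e^(- Re z)] to the power
    [n + 1], and the oscillating factor is bounded. *)
Lemma cpow_trunc_cvg z : 0 < complex.Re z ->
  ccvg (fun n => cpow (1 - trunc n) z) 0.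
Proof.
move=> z0.
have E n : expR (complex.Re z * ln (1 - trunc n)) = expR (- complex.Re z) ^+ n.+1.
  rewrite /trunc subKr lnXn ?expR_gt0// expRK -expRM_natl.
  by congr expR; rewrite -mulr_natl; ring.
have ce : expR (complex.Re z * ln (1 - trunc n)) @[n --> \oo] --> (0 : R).
  rewrite (_ : (fun n => _) = fun n => expR (- complex.Re z) ^+ n.+1); last exact/funext.
  rewrite (cvg_shiftS (fun n => expR (- complex.Re z) ^+ n)); apply: cvg_expr.
  by rewrite ger0_norm ?expR_ge0// -[ltRHS]expR0 ltr_expR oppr_lt0.
have bdd (b : nat -> R) : (forall n, `|b n| <= 1) ->
    expR (complex.Re z * ln (1 - trunc n)) * b n @[n --> \oo] --> (0 : R).
  move=> b1; apply/norm_cvg0P; apply: squeeze_cvgr ce; last exact: cvg_cst.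
  apply: nearW => n; rewrite normr_ge0 /= normrM ger0_norm ?expR_ge0//.
  by rewrite ler_piMr// expR_ge0.
rewrite /ccvg; split.
  under eq_cvg do rewrite Re_cpow; apply: bdd => n; exact: cos_max.
under eq_cvg do rewrite Im_cpow; apply: bdd => n; exact: sin_max.
Qed.

End ComplexPower.

(** * Integration by parts in one variable and inside the iterated integral *)

Section IntegrationByParts.
Context {R : realType}.
Local Notation mu := (@lebesgue_measure R).
Local Notation D := (`[0, 1]%classic : set R).
Local Notation point := (nat -> R).
Implicit Types (t : point) (F G : point -> R[i]).

Lemma good_continuous F t k : good F ->
  continuous (fun s => complex.Re (F (upd t k s))) /\
  continuous (fun s => complex.Im (F (upd t k s))).
Proof.
move=> [cF _]; split; apply: sequential_continuous => r s rs.
  by have [] := cF _ _ (pcvg_upd (k := k) (@pcvg_cst _ t) rs).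
by have [] := cF _ _ (pcvg_upd (k := k) (@pcvg_cst _ t) rs).
Qed.

(** The function [H(s) = (G(s) - G(0)) (1 - s)^z] vanishes at 0 by the subtracted constant and tends
    to 0 at 1 since [Re z > 0]. Its derivative [p] is the right integrand minus the left one, so the
    two integrals agree. *)
Lemma cintegral_by_parts j G G' (z : R[i]) t : 0 < complex.Re z ->
  good G -> good G' -> pderiv j G G' ->
  cintegral D (fun s => z * (G (upd t j s) - G (upd t j 0)) * cpow (1 - s) (z - 1)) =
  cintegral D (fun s => (1 - s%:C) * G' (upd t j s) * cpow (1 - s) (z - 1)).
Proof.
move=> z0 gG gG' dG; have iw := cintegrable_cpow z0.
(* The integrands are written as slices of good functions of [t], from which integrability and
   continuity follow. *)
pose A t := z * (G t - G (upd t j 0)).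
pose B t := (1 - (t j)%:C) * G' t.
pose w := fun _ : nat => fun s : R => cpow (1 - s) (z - 1).
have iw' k : cintegrable (w k) by [].
have gA : good A.
  by apply: goodM; [exact: good_cst|apply: goodB => //; exact: good_upd].
have gB : good B.
  by apply: goodM => //; apply: goodB; [exact: good_cst|exact: good_coord].
have gBA : good (fun t => B t - A t) by exact: goodB.
have AE s : A (upd t j s) = z * (G (upd t j s) - G (upd t j 0)) by rewrite /A upd_upd.
have BE s : B (upd t j s) = (1 - s%:C) * G' (upd t j s) by rewrite /B upd_same.
pose p s := (B (upd t j s) - A (upd t j s)) * cpow (1 - s) (z - 1).
have ip : cintegrable p := good_cintegrable iw' t j 0%N gBA.
have iA : cintegrable (fun s => A (upd t j s) * cpow (1 - s) (z - 1)) :=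
  good_cintegrable iw' t j 0%N gA.
pose H s := (G (upd t j s) - G (upd t j 0)) * cpow (1 - s) z.
have dRe (s : R) : s < 1 -> is_derive s 1 (fun s => complex.Re (H s)) (complex.Re (p s)).
  move=> s1; have [d1 d2] := dG t s.
  have e1 := is_derive_Re_cpow z s1; have e2 := is_derive_Im_cpow z s1.
  under eq_fun do rewrite Re_mul Re_add Im_add.
  apply: is_derive_eq.
  rewrite /p BE AE [cpow (1 - s) z]cpow_pred ?subr_gt0//.
  move: (cpow (1 - s) (z - 1)) => c.
  rewrite /GRing.scale !(Re_mul, Im_mul, Re_add, Im_add, Re_opp, Im_opp) /=.
  ring.
have dIm (s : R) : s < 1 -> is_derive s 1 (fun s => complex.Im (H s)) (complex.Im (p s)).
  move=> s1; have [d1 d2] := dG t s.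
  have e1 := is_derive_Re_cpow z s1; have e2 := is_derive_Im_cpow z s1.
  under eq_fun do rewrite Im_mul Re_add Im_add.
  apply: is_derive_eq.
  rewrite /p BE AE [cpow (1 - s) z]cpow_pred ?subr_gt0//.
  move: (cpow (1 - s) (z - 1)) => c.
  rewrite /GRing.scale !(Re_mul, Im_mul, Re_add, Im_add, Re_opp, Im_opp) /=.
  ring.
have cp (s : R) : s < 1 -> {for s, continuous (fun s => complex.Re (p s))} /\
    {for s, continuous (fun s => complex.Im (p s))}.
  move=> s1; have [c1 c2] := good_continuous t j gBA.
  have e1 := is_derive_continuous (is_derive_Re_cpow (z - 1) s1).
  have e2 := is_derive_continuous (is_derive_Im_cpow (z - 1) s1).
  split.
    rewrite (_ : (fun s => _) = fun s =>
      complex.Re (B (upd t j s) - A (upd t j s)) * complex.Re (cpow (1 - s) (z - 1)) -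
      complex.Im (B (upd t j s) - A (upd t j s)) * complex.Im (cpow (1 - s) (z - 1))).
      by apply: cvgB; apply: cvgM => //; [exact: c1|exact: c2].
    by apply/funext => x; exact: Re_mul.
  rewrite (_ : (fun s => _) = fun s =>
      complex.Re (B (upd t j s) - A (upd t j s)) * complex.Im (cpow (1 - s) (z - 1)) +
      complex.Im (B (upd t j s) - A (upd t j s)) * complex.Re (cpow (1 - s) (z - 1))).
    by apply: cvgD; apply: cvgM => //; [exact: c1|exact: c2].
  by apply/funext => x; exact: Im_mul.
have H0 : H 0 = 0 by rewrite /H subrr mul0r.
have [H1 H2] : ccvg (fun n => H (trunc n)) 0.
  rewrite -[X in ccvg _ X](mulr0 (G (upd t j 1) - G (upd t j 0))).
  apply: ccvgM; last exact: cpow_trunc_cvg.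
  have [cD _] := goodB gG (good_cst (G (upd t j 0))).
  exact: (cD _ _ (pcvg_upd (k := j) (@pcvg_cst _ t) trunc_cvg)).
have p0 : cintegral D p = 0.
  rewrite cintegralE; have [i1 i2] := ip.
  rewrite (improper_FTC dRe (fun s s1 => (cp s s1).1) i1 H1).
  rewrite (improper_FTC dIm (fun s s1 => (cp s s1).2) i2 H2).
  by rewrite H0 /= subrr.
transitivity (cintegral D (fun s => A (upd t j s) * cpow (1 - s) (z - 1))).
  by apply: eq_cintegral => s _; rewrite AE.
rewrite -[LHS]add0r -p0 -cintegralD//; apply: eq_cintegral => s _.
by rewrite /p -mulrDl subrK BE.
Qed.

Variable w : nat -> R -> R[i].
Hypothesis iw : forall k, cintegrable (w k).

(** Integrations above [j] only transport the equality. At the stage [j] itself the inner integrals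
    are absorbed into [wint j F], whose [j]-th derivative is [wint j F'], and the one-variable
    formula applies. *)
Lemma wint_by_parts k j F F' (z : R[i]) t : (j < k)%N -> 0 < complex.Re z ->
  w j = (fun s => cpow (1 - s) (z - 1)) -> good F -> good F' -> pderiv j F F' ->
  wint w k (fun t => z * (F t - F (upd t j 0))) t =
  wint w k (fun t => (1 - (t j)%:C) * F' t) t.
Proof.
move=> + z0 wj gF gF' dF; elim: k t => // k IH t.
rewrite ltnS leq_eqVlt => /predU1P[jk|jk] /=; last first.
  by apply: eq_cintegral => s _; rewrite IH.
rewrite -{}jk wj in IH *.
transitivity (cintegral D (fun s => z * (wint w j F (upd t j s) -
    wint w j F (upd t j 0)) * cpow (1 - s) (z - 1))).
  apply: eq_cintegral => s _; congr (_ * _).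
  have gF0 := good_upd j 0 gF.
  rewrite (wintZ iw (c := fun _ => z))//; last exact: goodB.
  rewrite (wintD iw)//; last exact: goodN.
  congr (_ * (_ + _)).
  under [X in wint w j X _]eq_fun do rewrite -mulN1r.
  by rewrite (wintZ iw (c := fun _ => -1))// mulN1r wint_upd// upd_upd.
rewrite (cintegral_by_parts t z0 (good_wint iw j gF) (good_wint iw j gF')
  (wint_pderiv iw (leqnn j) gF gF' dF)).
apply: eq_cintegral => s _; congr (_ * _).
rewrite (wintZ iw (c := fun t => 1 - (t j)%:C))// ?upd_same//.
by move=> u i x ij; rewrite upd_other// gt_eqF.
Qed.

(** The weights of the coordinates from [k] on are constant during the first [k] integrations and
    come out, one of them being absorbed at each stage; for [k = n] no factor remains. *)
Lemma iter_int01E (n k : nat) F t : (k <= n)%N -> good F ->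
  iter_int01 k (fun t => F t * \prod_(0 <= j < n) w j (t j)) t =
  wint w k F t * \prod_(k <= j < n) w j (t j).
Proof.
move=> + gF; elim: k t => [//|k IH] t kn /=.
rewrite mulrC -cintegralZ; last by apply: good_cintegrable => //; exact: good_wint.
apply: eq_cintegral => s _.
rewrite -/(upd t k s) IH ?(ltnW kn)// big_ltn// upd_same mulrC.
rewrite [RHS]mulrCA mulrC; congr (_ * _); rewrite [RHS]mulrC; congr (_ * _).
by apply: eq_big_nat => j /andP[kj _]; rewrite upd_other// gtn_eqF.
Qed.

End IntegrationByParts.

(** * Directional derivatives of smooth functions *)

Section DirectionalDerivative.
Context {R : realType} {N : nat}.
Local Notation V := 'rV[R]_N.
Implicit Types (u : V -> R) (x v y : V).

(** The difference quotients along a line are those of the directional derivative, so the two are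
    exchanged without a chain rule. *)
Lemma line_quotient u x v (s h : R) :
  h^-1 *: (u (x + (h *: 1 + s) *: v) - u (x + s *: v)) =
  h^-1 *: (u (h *: v + (x + s *: v)) - u (x + s *: v)).
Proof. by rewrite [h *: 1]mulr1 scalerDl [h *: v + _]addrC addrA addrAC. Qed.

Lemma is_derive_line u x v (s : R) : derivable u (x + s *: v) v ->
  is_derive s 1 (fun r => u (x + r *: v)) ('D_v u (x + s *: v)).
Proof.
rewrite /derive /derivable => du.
by apply: DeriveDef; rewrite /derive /derivable; under eq_fun do rewrite /= line_quotient.
Qed.

Lemma line_is_derive u x v (d : R) :
  is_derive (0 : R) 1 (fun r : R => u (x + r *: v)) d -> is_derive x v u d.
Proof.
move=> [d1 d2]; move: d1 d2; rewrite /derive /derivable.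
under eq_fun do rewrite /= line_quotient scale0r addr0.
move=> d1 d2; apply: DeriveDef => //.
Qed.

Section Smooth.
Variable u : V -> R.
Hypothesis du : forall x v, derivable u x v.

Lemma deriveZ_dir x v (c : R) : 'D_(c *: v) u x = c * 'D_v u x.
Proof.
have h1 := @is_derive_line u x v 0 (@du _ _).
have h2 : is_derive (0 : R) 1 (fun r => u (x + r *: (c *: v))) (c * 'D_v u x).
  have dc : is_derive (0 : R) 1 (fun r => c * r) c.
    by apply: is_derive_eq; rewrite /GRing.scale /= mulr1.
  rewrite scale0r addr0 in h1.
  have h1' : is_derive (c * 0) 1 (fun r : R => u (x + r *: v)) ('D_v u x) by rewrite mulr0.
  have := is_derive1_comp h1' dc; rewrite mulrC.
  by congr (is_derive _ _ _ _); apply/funext => r /=; rewrite scalerA mulrC.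
by have [_ ->] := line_is_derive h2.
Qed.

Hypothesis cdu : forall v, continuous ('D_v u).

(** Smoothness is given through directional derivatives, so additivity in the direction has to be
    proved. The step [r (v + y)] is made along [v] and then along [y]; the second increment is
    treated by the mean value theorem and the continuity of ['D_y u]. *)
Lemma deriveD_dir x v y : 'D_(v + y) u x = 'D_v u x + 'D_y u x.
Proof.
suff h : is_derive (0 : R) 1 (fun r => u (x + r *: (v + y))) ('D_v u x + 'D_y u x).
  by have [_ ->] := line_is_derive h.
apply: is_derive_sequential => r r0 cr.
have mv i : exists c, `|c - 0| <= `|r i - 0| /\
    u (x + r i *: v + r i *: y) - u (x + r i *: v + 0 *: y) =
    'D_y u (x + r i *: v + c *: y) * (r i - 0).
  exact: (@mean_value _ _ _ (fun s => @is_derive_line u (x + r i *: v) y s (@du _ _))).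
have [c cE] := choice mv.
have cc : c i @[i --> \oo] --> (0 : R).
  apply/cvgrPdist_le => e e0; move/cvgrPdist_le : cr => /(_ e e0).
  by apply: filterS => i; have [h _] := cE i; rewrite distrC => /(le_trans h); rewrite distrC.
rewrite [X in _ --> X]addrC.
rewrite (_ : (fun i => _) = fun i => 'D_y u (x + r i *: v + c i *: y) +
    (r i)^-1 * (u (x + r i *: v) - u x)); last first.
  apply/funext => i; have [_] := cE i.
  rewrite !subr0 !scale0r !addr0 scalerDr addrA => e.
  have ri : r i != 0 := r0 i.
  rewrite -[X in _ * X](subrKA (u (x + r i *: v))) mulrDr e.
  by rewrite mulrCA mulVf// mulr1.
have toz (b : nat -> R) (z : V) : b i @[i --> \oo] --> (0 : R) ->
    b i *: z @[i --> \oo] --> (0 : V).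
  by move=> b0; rewrite -[X in _ --> X](scale0r z); apply: cvgZr_tmp.
apply: cvgD.
  apply: (continuous_cvg _ (@cdu y x)).
  rewrite -[X in _ --> X]addr0; apply: cvgD; last exact: toz.
  by rewrite -[X in _ --> X]addr0; apply: cvgD; [exact: cvg_cst|exact: toz].
have [d1 d2] := @is_derive_line u x v 0 (@du _ _).
move: d1 d2; rewrite scale0r addr0 => d1 d2.
have : h^-1 *: (u (x + (h *: 1 + 0) *: v) - u (x + 0 *: v)) @[h --> 0^'] --> 'D_v u x.
  by rewrite -d2; exact: d1.
move=> /cvgr_dnbhsP/(_ r (conj r0 cr)).
by under eq_cvg do rewrite addr0 [_ *: 1]mulr1 scale0r addr0.
Qed.

Lemma derive_sum_dir x (I : Type) (s : seq I) (c : I -> R) (v : I -> V) :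
  'D_(\sum_(i <- s) c i *: v i) u x = \sum_(i <- s) c i * 'D_(v i) u x.
Proof.
elim: s => [|i s IH]; first by rewrite !big_nil derive0.
by rewrite !big_cons deriveD_dir deriveZ_dir IH.
Qed.

End Smooth.

Lemma continuous_bounded_ball u : continuous u ->
  forall C : R, exists K : R, forall x, `|x| <= C -> `|u x| <= K.
Proof.
move=> cu C.
have cB : compact [set x : V | `|x| <= C].
  apply: bounded_closed_compact.
    by exists C; split; [exact: num_real|move=> M CM x /= /le_trans; apply; exact: ltW].
  have := @closed_comp _ _ (fun x : V => `|x|) [set y : R | y <= C].
  by apply; [move=> x _; exact: norm_continuous|exact: closed_le].
have [M [_ MB]] := compact_bounded (continuous_compact (continuous_subspaceT cu) cB).
exists (M + 1) => x xC; apply: (MB (M + 1)); first by rewrite ltrDl.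
by exists x.
Qed.

End DirectionalDerivative.

(** * Good maps with values in normed spaces *)

Section GoodMaps.
Context {R : realType}.
Local Notation point := (nat -> R).

(** The counterpart of [good] for a normed space: the vector [hmap] and its real coefficients, taken
    in [R^o], then share the same closure lemmas. *)
Definition vgood (W : normedModType R) (P : point -> W) : Prop :=
  (forall u t, pcvg u t -> P (u i) @[i --> \oo] --> P t) /\
  (forall M : point, exists C : R, forall t, (forall j, `|t j| <= M j) -> `|P t| <= C).

Lemma vgood_cst (W : normedModType R) (a : W) : vgood (fun _ => a).
Proof. by split => [u t _|M]; [exact: cvg_cst|exists `|a|]. Qed.

Lemma vgoodD (W : normedModType R) (P Q : point -> W) : vgood P -> vgood Q ->
  vgood (fun t => P t + Q t).
Proof.
move=> [cP bP] [cQ bQ]; split=> [u t ut|M]; first by apply: cvgD; [exact: cP|exact: cQ].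
have [C PC] := bP M; have [C' QC] := bQ M; exists (C + C') => t tM.
by apply: (le_trans (ler_normD _ _)); apply: lerD; [exact: PC|exact: QC].
Qed.

Lemma vgoodZ (W : normedModType R) (c : point -> R) (P : point -> W) :
  vgood (c : point -> R^o) -> vgood P -> vgood (fun t => c t *: P t).
Proof.
move=> [cc bc] [cP bP]; split=> [u t ut|M]; first by apply: cvgZ; [exact: cc|exact: cP].
have [C PC] := bc M; have [C' QC] := bP M; exists (C * C') => t tM.
by rewrite normrZ ler_pM//; [exact: PC|exact: QC].
Qed.

Lemma vgood_sum (W : normedModType R) (I : finType) (P : I -> point -> W) :
  (forall i, vgood (P i)) -> vgood (fun t => \sum_i P i t).
Proof.
move=> gP; elim: (index_enum I) => [|i s IH].
  by under eq_fun do rewrite big_nil; exact: vgood_cst.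
by under eq_fun do rewrite big_cons; exact: vgoodD.
Qed.

Lemma vgood_coord j : vgood ((fun t => t j) : point -> R^o).
Proof. by split => [u t ut|M]; [exact: ut|exists (M j)]. Qed.

Lemma vgood_real (c : point -> R) : vgood (c : point -> R^o) ->
  good (fun t => (c t)%:C).
Proof.
move=> [cc bc]; split=> [u t ut|M].
  by split; [exact: cc|exact: cvg_cst].
have [C cC] := bc M; exists C => _ t tM /=; rewrite normr0; split; first exact: cC.
by apply: le_trans (cC t tM).
Qed.

(** [P] maps a box into a closed ball, on which the continuous parts of [f] are bounded by
    compactness. *)
Lemma good_comp (N : nat) (f : 'rV[R]_N -> R[i]) (P : point -> 'rV[R]_N) :
  continuous (fun x => complex.Re (f x)) -> continuous (fun x => complex.Im (f x)) ->
  vgood P -> good (fun t => f (P t)).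
Proof.
move=> c1 c2 [cP bP]; split=> [u t ut|M].
  split.
    by apply: (continuous_cvg _ (c1 (P t))); exact: cP.
  by apply: (continuous_cvg _ (c2 (P t))); exact: cP.
have [C PC] := bP M.
have [K1 h1] := continuous_bounded_ball c1 C.
have [K2 h2] := continuous_bounded_ball c2 C.
exists (Num.max K1 K2) => _ t tM.
by rewrite !le_max h1 ?h2 ?orbT//; exact: PC.
Qed.

End GoodMaps.

(** * The intertwining relation *)

Section Dunkl.
Context {R : realType} {N n : nat}.
Local Notation V := 'rV[R]_N.
Local Notation point := (nat -> R).
Variables (alpha : 'I_n -> V) (kappa : 'I_n -> R[i]).
Implicit Types (t : point) (x y v xi : V) (f : V -> R[i]).

Lemma dotpDl x y v : dotp (x + y) v = dotp x v + dotp y v.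
Proof. by rewrite /dotp -big_split; apply: eq_bigr => i _; rewrite mxE mulrDl. Qed.

Lemma dotpZl (c : R) x v : dotp (c *: x) v = c * dotp x v.
Proof. by rewrite /dotp mulr_sumr; apply: eq_bigr => i _; rewrite mxE mulrA. Qed.

Lemma dotpC x y : dotp x y = dotp y x.
Proof. by apply: eq_bigr => i _; rewrite mulrC. Qed.

Lemma dotp_self_neq0 x v : dotp x v != 0 -> dotp v v != 0.
Proof.
apply: contraNneq => /eqP v0; have {}v0 i : v 0 i = 0.
  move: v0; rewrite psumr_eq0; last by move=> j _; rewrite -expr2 sqr_ge0.
  by move=> /allP/(_ i (mem_index_enum _)); rewrite /= mulf_eq0 orbb => /eqP.
by rewrite /dotp big1// => i _; rewrite v0 mulr0.
Qed.

Local Notation cube t := (fun j : 'I_n => t (nat_of_ord j)).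

Lemma hmap_line t x v (c : R) :
  hmap alpha (cube t) (x + c *: v) =
  hmap alpha (cube t) x + c *: hmap alpha (cube t) v.
Proof.
rewrite /hmap scalerDr addrACA; congr (_ + _).
rewrite scaler_sumr -big_split; apply: eq_bigr => j _ /=.
rewrite dotpDl dotpZl scalerA -scalerDl; congr (_ *: _); ring.
Qed.

Lemma hmap_upd t (j : 'I_n) (r : R) x :
  hmap alpha (cube (upd t j r)) x = hmap alpha (cube (upd t j 0)) x +
    r *: ((dotp x (alpha j) / dotp (alpha j) (alpha j)) *: alpha j).
Proof.
rewrite /hmap -addrA; congr (_ + _).
rewrite (bigD1 j)//= [in RHS](bigD1 j)//= !upd_same addrAC scalerA -scalerDl.
congr (_ *: _ + _); first by ring.
by apply: eq_bigr => i ij; rewrite !upd_other.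
Qed.

Lemma hmap_param t (r : R) x : hmap alpha (cube (upd t n r)) x = hmap alpha (cube t) x.
Proof.
by congr (hmap _ _ _); apply/funext => j; rewrite upd_other// ltn_eqF.
Qed.

(** [tau] is the orthogonal projection along [alpha j], not the reflection: it annihilates the
    [j]-th coefficient and, by orthogonality, keeps the others, just as [t_j = 0] does. *)
Lemma hmap_tau t (j : 'I_n) x : (forall i, i != j -> dotp (alpha j) (alpha i) = 0) ->
  dotp (alpha j) (alpha j) != 0 ->
  hmap alpha (cube t) (tau (alpha j) x) = hmap alpha (cube (upd t j 0)) x.
Proof.
move=> orth aj; have tauE i : dotp (tau (alpha j) x) (alpha i) =
    if i == j then 0 else dotp x (alpha i).
  rewrite /tau -scaleNr dotpDl dotpZl; case: eqP => [->|/eqP ij].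
    by rewrite mulNr divfK// subrr.
  by rewrite (orth i)// mulr0 addr0.
rewrite /hmap (bigD1 j)//= [in RHS](bigD1 j)//= tauE eqxx /= upd_same.
rewrite mulr0 mul0r scale0r add0r /tau -addrA; congr (_ + _).
rewrite sub0r mulN1r mulNr scaleNr; congr (_ + _).
by apply: eq_bigr => i ij; rewrite tauE (negbTE ij) upd_other.
Qed.

Lemma vgood_hmap x xi : vgood (fun t => hmap alpha (cube t) (x + t n *: xi)).
Proof.
have gy : vgood (fun t => x + t n *: xi).
  by apply: vgoodD; [exact: vgood_cst|apply: vgoodZ; [exact: vgood_coord|exact: vgood_cst]].
apply: vgoodD => //; apply: vgood_sum => j; apply: vgoodZ; last exact: vgood_cst.
have gm (c d : point -> R) : vgood (c : point -> R^o) -> vgood (d : point -> R^o) ->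
  vgood ((fun t => c t * d t) : point -> R^o) by exact: (@vgoodZ R R^o).
apply: (gm _ (fun _ => _)); last exact: (@vgood_cst R R^o).
apply: (gm); first by apply: (@vgoodD R R^o); [exact: vgood_coord|exact: (@vgood_cst R R^o)].
under eq_fun do rewrite dotpDl dotpZl.
apply: (@vgoodD R R^o); first exact: (@vgood_cst R R^o).
by apply: gm; [exact: vgood_coord|exact: (@vgood_cst R R^o)].
Qed.

Lemma vgood_hmap0 x : vgood (fun t => hmap alpha (cube t) x).
Proof.
by have := vgood_hmap x 0; under eq_fun do rewrite scaler0 addr0.
Qed.

Lemma Re_cderive f xi x :
  complex.Re (cderive f xi x) = 'D_xi (fun y => complex.Re (f y)) x.
Proof. by rewrite /cderive addi_parts. Qed.

Lemma Im_cderive f xi x :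
  complex.Im (cderive f xi x) = 'D_xi (fun y => complex.Im (f y)) x.
Proof. by rewrite /cderive addi_parts. Qed.

(* The exponents are extended by 1 to the indices [k >= n], so that all weights
   are integrable. *)
Definition factor_weight (k : nat) (s : R) : R[i] :=
  cpow (1 - s) (oapp kappa 1 (insub k) - 1).

Hypothesis kappa_gt0 : forall j, 0 < complex.Re (kappa j).

Lemma cintegrable_factor_weight k : cintegrable (factor_weight k).
Proof. by apply: cintegrable_cpow; case: insub => [j|] //=; exact: ltr01. Qed.

Lemma factor_weightE (j : 'I_n) : factor_weight j = fun s => cpow (1 - s) (kappa j - 1).
Proof. by apply/funext => s; rewrite /factor_weight valK. Qed.

Lemma weightE t : weight kappa (cube t) = \prod_(0 <= k < n) factor_weight k (t k).
Proof. by rewrite big_mkord; apply: eq_bigr => j _; rewrite factor_weightE. Qed.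

Lemma chiE f x : good (fun t => f (hmap alpha (cube t) x)) ->
  chi alpha kappa f x = (Gamma_kappa kappa)^-1 *
    wint factor_weight n (fun t => f (hmap alpha (cube t) x)) (fun _ => 0).
Proof.
move=> gf; rewrite /chi /cube_integral; congr (_ * _).
under [X in iter_int01 n X _]eq_fun do rewrite weightE.
by rewrite (iter_int01E cintegrable_factor_weight)// big_geq// mulr1.
Qed.

Section SmoothFunction.
Variable f : V -> R[i].
Hypothesis smooth_f : smooth f.

Let dRe x v : derivable (fun y => complex.Re (f y)) x v.
Proof. by have [/(_ [::])[]] := smooth_f. Qed.
Let dIm x v : derivable (fun y => complex.Im (f y)) x v.
Proof. by have [_ /(_ [::])[]] := smooth_f. Qed.
Let cRe : continuous (fun y => complex.Re (f y)).
Proof. by have [/(_ [::])[]] := smooth_f. Qed.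
Let cIm : continuous (fun y => complex.Im (f y)).
Proof. by have [_ /(_ [::])[]] := smooth_f. Qed.
Let cdRe v : continuous ('D_v (fun y => complex.Re (f y))).
Proof. by have [/(_ [:: v])[]] := smooth_f. Qed.
Let cdIm v : continuous ('D_v (fun y => complex.Im (f y))).
Proof. by have [_ /(_ [:: v])[]] := smooth_f. Qed.

Lemma good_smooth (P : point -> V) : vgood P -> good (fun t => f (P t)).
Proof. exact: good_comp. Qed.

Lemma good_cderive v (P : point -> V) : vgood P -> good (fun t => cderive f v (P t)).
Proof.
apply: (@good_comp _ _ (cderive f v)).
  by rewrite (funext (Re_cderive f v)); exact: cdRe.
by rewrite (funext (Im_cderive f v)); exact: cdIm.
Qed.

Lemma cderive_hmap t xi y :
  cderive f (hmap alpha (cube t) xi) y = cderive f xi y + \sum_(j < n)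
    ((t j - 1) * dotp xi (alpha j) / dotp (alpha j) (alpha j))%:C *
      cderive f (alpha j) y.
Proof.
apply: complex_parts.
  rewrite [RHS]Re_add !Re_cderive (deriveD_dir dRe cdRe) (derive_sum_dir dRe cdRe).
  rewrite (big_morph (@complex.Re R) (@Re_add R) (erefl : complex.Re 0 = 0)); congr (_ + _).
  by apply: eq_bigr => j _; rewrite Re_mul Re_cderive /= mul0r subr0.
rewrite [RHS]Im_add !Im_cderive (deriveD_dir dIm cdIm) (derive_sum_dir dIm cdIm).
rewrite (big_morph (@complex.Im R) (@Im_add R) (erefl : complex.Im 0 = 0)); congr (_ + _).
by apply: eq_bigr => j _; rewrite Im_mul Im_cderive /= mul0r addr0.
Qed.

Lemma is_derive_line_parts x v (s : R) :
  is_derive s 1 (fun r : R => complex.Re (f (x + r *: v)))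
    (complex.Re (cderive f v (x + s *: v))) /\
  is_derive s 1 (fun r : R => complex.Im (f (x + r *: v)))
    (complex.Im (cderive f v (x + s *: v))).
Proof.
rewrite Re_cderive Im_cderive; split.
  exact: (@is_derive_line _ _ (fun y => complex.Re (f y)) x v s (@dRe _ _)).
exact: (@is_derive_line _ _ (fun y => complex.Im (f y)) x v s (@dIm _ _)).
Qed.

(** By linearity of [h_t], moving the coordinate [n] traces the line through [h_t x] in the
    direction [h_t xi]. *)
Lemma pderiv_translation x xi :
  pderiv n (fun t => f (hmap alpha (cube t) (x + t n *: xi)))
    (fun t => cderive f (hmap alpha (cube t) xi) (hmap alpha (cube t) (x + t n *: xi))).
Proof.
move=> t s.
have E r : hmap alpha (cube (upd t n r)) (x + upd t n r n *: xi) =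
    hmap alpha (cube t) x + r *: hmap alpha (cube t) xi.
  by rewrite hmap_param upd_same hmap_line.
have [d1 d2] := is_derive_line_parts (hmap alpha (cube t) x) (hmap alpha (cube t) xi) s.
by rewrite E hmap_param; split;
  [under eq_fun do rewrite E|under eq_fun do rewrite E].
Qed.

Lemma pderiv_dilation x (j : 'I_n) :
  pderiv j (fun t => f (hmap alpha (cube t) x))
    (fun t => (dotp x (alpha j) / dotp (alpha j) (alpha j))%:C *
              cderive f (alpha j) (hmap alpha (cube t) x)).
Proof.
move=> t s; set c := dotp x (alpha j) / _.
have := is_derive_line_parts (hmap alpha (cube (upd t j 0)) x) (c *: alpha j) s.
have -> y : cderive f (c *: alpha j) y = c%:C * cderive f (alpha j) y.
  apply: complex_parts.
    by rewrite Re_mul !Re_cderive (deriveZ_dir dRe) /= mul0r subr0.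
  by rewrite Im_mul !Im_cderive (deriveZ_dir dIm) /= mul0r addr0.
move=> [d1 d2]; rewrite hmap_upd.
by split; under eq_fun do rewrite hmap_upd.
Qed.

End SmoothFunction.
End Dunkl.

(** * Derivative and difference quotients of [chi f], and their cancellation *)

Section Intertwining.
Context {R : realType} {N n : nat}.
Local Notation V := 'rV[R]_N.
Local Notation point := (nat -> R).
Variables (alpha : 'I_n -> V) (kappa : 'I_n -> R[i]).
Hypothesis kappa_gt0 : forall j, 0 < complex.Re (kappa j).
Variable f : V -> R[i].
Hypothesis smooth_f : smooth f.
Variables xi x : V.

Local Notation cube t := (fun j : 'I_n => t (nat_of_ord j)).
Local Notation W := (wint (factor_weight kappa) n).
Local Notation origin := ((fun _ => 0) : point).
Local Notation E v := (fun t : point => cderive f v (hmap alpha (cube t) x)).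

Let iw := cintegrable_factor_weight kappa_gt0.

Lemma wint_sum k (I : finType) (F_ : I -> point -> R[i]) t :
  (forall i, good (F_ i)) ->
  wint (factor_weight kappa) k (fun t => \sum_i F_ i t) t = \sum_i wint (factor_weight kappa) k (F_ i) t.
Proof.
move=> gF.
(* Goodness of the partial sums is carried along, as [wintD] asks for it at each step. *)
suff [] : good (fun t => \sum_i F_ i t) /\
  wint (factor_weight kappa) k (fun t => \sum_i F_ i t) t = \sum_i wint (factor_weight kappa) k (F_ i) t by [].
elim: (index_enum I) => [|i s [IHg IH]].
  under eq_fun do rewrite big_nil; split; first exact: good_cst.
  rewrite big_nil -[RHS](mul0r (wint (factor_weight kappa) k (fun _ => 0) t)).
  rewrite -(wintZ iw (c := fun _ => 0))//; last exact: good_cst.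
  by apply: eq_wint => u; rewrite mul0r.
under eq_fun do rewrite big_cons; split; first exact: goodD.
by rewrite (wintD iw)// IH big_cons.
Qed.

Let good_E v : good (E v).
Proof. by apply: good_cderive => //; exact: vgood_hmap0. Qed.

(* The translation parameter is carried by the coordinate [n], which [W] does not
   integrate out. *)
Lemma chi_line (r : R) : chi alpha kappa f (x + r *: xi) = (Gamma_kappa kappa)^-1 *
  W (fun t => f (hmap alpha (cube t) (x + t n *: xi))) (upd origin n r).
Proof.
rewrite chiE//; last by apply: good_smooth => //; exact: vgood_hmap0.
congr (_ * _); rewrite -wint_upd//; apply: eq_wint => t.
by rewrite hmap_param upd_same.
Qed.

(** By [chi_line] this is a derivative in the coordinate [n] at 0, which may be taken under the
    integral. *)
Lemma chi_derive : cderivable (chi alpha kappa f) x xi /\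
  cderive (chi alpha kappa f) xi x = (Gamma_kappa kappa)^-1 *
    W (fun t => cderive f (hmap alpha (cube t) xi) (hmap alpha (cube t) x)) origin.
Proof.
pose F (t : point) := f (hmap alpha (cube t) (x + t n *: xi)).
pose G (t : point) := cderive f (hmap alpha (cube t) xi)
  (hmap alpha (cube t) (x + t n *: xi)).
have gF : good F by apply: good_smooth => //; exact: vgood_hmap.
have gG : good G.
  rewrite /G; under eq_fun do rewrite cderive_hmap//.
  apply: goodD; first by apply: good_cderive => //; exact: vgood_hmap.
  apply: good_sum => j; apply: goodM; last first.
    by apply: good_cderive => //; exact: vgood_hmap.
  apply: vgood_real; under eq_fun do rewrite -mulrA mulrC.
  apply: (@vgoodZ R R^o); first exact: (@vgood_cst R R^o).
  by apply: (@vgoodD R R^o); [exact: vgood_coord|exact: (@vgood_cst R R^o)].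
have [d1 d2] := wint_pderiv iw (leqnn n) gF gG
  (pderiv_translation alpha smooth_f x xi) origin 0.
have eG : W G (upd origin n 0) =
    W (fun t => cderive f (hmap alpha (cube t) xi) (hmap alpha (cube t) x)) origin.
  rewrite -wint_upd//; apply: eq_wint => t.
  by rewrite /G !hmap_param upd_same scale0r addr0.
rewrite eG in d1 d2; set L := W _ origin in d1 d2 *.
set g := (Gamma_kappa kappa)^-1.
have h1 : is_derive x xi (fun y => complex.Re (chi alpha kappa f y)) (complex.Re (g * L)).
  apply: line_is_derive; under eq_fun do rewrite chi_line Re_mul.
  by apply: is_derive_eq; rewrite Re_mul.
have h2 : is_derive x xi (fun y => complex.Im (chi alpha kappa f y)) (complex.Im (g * L)).
  apply: line_is_derive; under eq_fun do rewrite chi_line Im_mul.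
  by apply: is_derive_eq; rewrite Im_mul.
have [e1 v1] := h1; have [e2 v2] := h2; split; first by [].
by apply: complex_parts; rewrite ?Re_cderive ?Im_cderive.
Qed.

Let coef (j : 'I_n) : R := dotp xi (alpha j) / dotp (alpha j) (alpha j).
(** The products [coef j * X j] are the common quantity: up to the factor [1 / Gamma(kappa)], they
    occur with a minus sign in the derivative of [chi f] and with a plus sign in the difference
    quotients. *)
Let X (j : 'I_n) : R[i] := W (fun t => (1 - (t j)%:C) * E (alpha j) t) origin.

Let good_X (j : 'I_n) : good (fun t => (1 - (t j)%:C) * E (alpha j) t).
Proof.
by apply: goodM => //; apply: goodB; [exact: good_cst|exact: good_coord].
Qed.

Lemma cderive_chi : cderive (chi alpha kappa f) xi x = (Gamma_kappa kappa)^-1 *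
  (W (E xi) origin - \sum_j (coef j)%:C * X j).
Proof.
rewrite chi_derive.2; congr (_ * _).
(* The coefficient [t_j - 1] is turned into [- (1 - t_j)], the form that integration by parts
   produces. *)
transitivity (W (fun t => E xi t +
    \sum_j (- (coef j)%:C) * ((1 - (t (nat_of_ord j))%:C) * E (alpha j) t)) origin).
  apply: eq_wint => t; rewrite cderive_hmap//; congr (_ + _).
  apply: eq_bigr => j _; rewrite mulrA; congr (_ * _).
  apply: complex_parts; rewrite ?(Re_mul, Im_mul, Re_add, Im_add, Re_opp, Im_opp) /=;
    by rewrite /coef; ring.
have gX j : good (fun t => - (coef j)%:C * ((1 - (t (nat_of_ord j))%:C) * E (alpha j) t)).
  by apply: goodM; [exact: good_cst|exact: good_X].
rewrite (wintD iw)//; last exact: good_sum.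
rewrite wint_sum// -sumrN; congr (_ + _); apply: eq_bigr => j _.
by rewrite (wintZ iw (c := fun _ => - (coef j)%:C))// mulNr.
Qed.

Hypothesis orth : forall i j, i != j -> dotp (alpha j) (alpha i) = 0.
Hypothesis x_regular : forall j, dotp x (alpha j) != 0.

(** The multiplicity [kappa j] is the factor consumed by integration by parts in [t_j], and the
    denominator [<x, alpha_j>] cancels against the slope [c] of [h(t, x)] in [t_j]. *)
Lemma chi_difference (j : 'I_n) :
  kappa j * (dotp (alpha j) xi)%:C *
    (chi alpha kappa f x - chi alpha kappa f (tau (alpha j) x)) / (dotp x (alpha j))%:C =
  (Gamma_kappa kappa)^-1 * ((coef j)%:C * X j).
Proof.
pose F t := f (hmap alpha (cube t) x).
have gF : good F by apply: good_smooth => //; exact: vgood_hmap0.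
have aj := dotp_self_neq0 (x_regular j).
pose c := dotp x (alpha j) / dotp (alpha j) (alpha j).
have gcE : good (fun t => c%:C * E (alpha j) t) by apply: goodM => //; exact: good_cst.
have parts := wint_by_parts iw origin (ltn_ord j) (kappa_gt0 j) (factor_weightE kappa j)
  gF gcE (pderiv_dilation alpha smooth_f x j).
have gF0 : good (fun t => F (upd t j 0)) by exact: good_upd.
have diff : kappa j * (W F origin - W (fun t => F (upd t j 0)) origin) = c%:C * X j.
  transitivity (W (fun t => kappa j * (F t - F (upd t j 0))) origin).
    rewrite (wintZ iw (c := fun _ => kappa j))//; last exact: goodB.
    rewrite (wintD iw)//; last exact: goodN.
    congr (_ * (_ + _)).
    under [in RHS]eq_fun do rewrite -mulN1r.
    by rewrite (wintZ iw (c := fun _ => -1))// mulN1r.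
  rewrite parts -(wintZ iw (c := fun _ => c%:C))//.
  by apply: eq_wint => t; rewrite mulrCA.
have tauF : chi alpha kappa f (tau (alpha j) x) =
    (Gamma_kappa kappa)^-1 * W (fun t => F (upd t j 0)) origin.
  rewrite chiE//; last by apply: good_smooth => //; exact: vgood_hmap0.
  congr (_ * _); apply: eq_wint => t; rewrite (@hmap_tau _ _ _ alpha t j x)// => i ij.
  exact: orth.
rewrite tauF chiE// -/F -mulrBr.
rewrite (_ : kappa j * _ * _ = (Gamma_kappa kappa)^-1 * (dotp (alpha j) xi)%:C *
  (kappa j * (W F origin - W (fun t => F (upd t j 0)) origin))); last by ring.
rewrite diff -!mulrA; congr (_ * _).
rewrite /c /coef dotpC !rmorphM /=; field.
by rewrite !fmorph_eq0 aj x_regular.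
Qed.

Lemma dunkl_chi :
  Tdunkl alpha kappa xi (chi alpha kappa f) x = chi alpha kappa (cderive f xi) x.
Proof.
rewrite /Tdunkl (eq_bigr _ (fun j _ => chi_difference j)) cderive_chi.
by rewrite -mulr_sumr -mulrDr subrK chiE.
Qed.

End Intertwining.

Theorem theorem4p1 (R : realType) (N n : nat) (Rs : seq 'rV[R]_N)
    (alpha : 'I_n -> 'rV[R]_N) (kappa : 'I_n -> R[i]) :
  root_system Rs ->
  injective alpha ->
  positive_orthogonal_subsystem [seq alpha j | j : 'I_n] Rs ->
  (forall j, 0 < complex.Re (kappa j)) ->
  forall (f : 'rV[R]_N -> R[i]), smooth f ->
  forall (xi x : 'rV[R]_N), (forall j, dotp x (alpha j) != 0) ->
    cderivable (chi alpha kappa f) x xi /\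
    Tdunkl alpha kappa xi (chi alpha kappa f) x
      = chi alpha kappa (cderive f xi) x.
Proof.
move=> _ alpha_inj [R2 [[_ orthR2] R2E neg]] kappa_gt0 f smooth_f xi x x_reg.
have aP j : alpha j \in [seq alpha j | j : 'I_n] by apply/fintype.imageP; exists j.
have aR2 j : alpha j \in R2 by rewrite R2E mem_cat aP.
split; first exact: (chi_derive alpha kappa_gt0 smooth_f xi x).1.
(* Distinct indices give distinct roots by injectivity, and these are not opposite because the
   subsystem is positive; hence they are orthogonal. *)
apply: dunkl_chi => // i j ij; apply: orthR2 => //.
  by apply: contra ij => /eqP/alpha_inj ->.
by apply/eqP => aij; have /negP[] := neg _ (aP j); rewrite -aij.
Qed.
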